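(* Let $N=1$ and let $H(x,p)=\sigma(x)m(|p|)$ for $(x,p)\in\mathbf{T}\times\mathbf{R}$, where $\sigma:\mathbf{T}\to(0,\infty)$ is continuous, $m:[0,\infty)\to(0,1)$ is Lipschitz continuous and strictly increasing, and $m(r)\to1$ as $r\to\infty$. Let $\overline{\sigma}=\max_{\mathbf{T}}\sigma$, $\underline{\sigma}=\min_{\mathbf{T}}\sigma$, $m_0=m(0)$, and let $\mathcal{D}\subset\mathbf{R}$ be the solvability set of $H$. (1) If $\overline{\sigma}m_0\ge\underline{\sigma}$, then $\mathcal{D}=\emptyset$. (2) If $\overline{\sigma}m_0<\underline{\sigma}$, then $$\mathcal{D}=\begin{cases}\left(-\int_0^1f_{\underline{\sigma}}(z)\,dz,\ \int_0^1f_{\underline{\sigma}}(z)\,dz\right)&\text{if }f_{\underline{\sigma}}\in L^1(0,1),\\ \mathbf{R}&\text{otherwise.}\end{cases}$$ Moreover, for $P\in\mathcal{D}$, the critical value $c$ of the cell problem $H(x,u'(x)+P)=a$ in $\mathbf{T}$ is given by $$c=\begin{cases}\overline{\sigma}m_0&\text{if }|P|\le\int_0^1f_{\overline{\sigma}m_0}(z)\,dz,\\ a\ \text{ such that }|P|=\int_0^1f_a(z)\,dz&\text{otherwise,}\end{cases}$$ where in the second case $a\in[\overline{\sigma}m_0,\underline{\sigma})$.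
   Context: $\mathbf{T}=\mathbf{R}/\mathbf{Z}$; functions on $\mathbf{T}$ are identified with $\mathbf{Z}$-periodic functions on $\mathbf{R}$. $\mathrm{Lip}(\mathbf{T})$ is the set of Lipschitz continuous functions on $\mathbf{T}$. Let $m^{-1}:[m_0,1)\to[0,\infty)$ be the inverse function of $m$, and set $m^{-1}(1)=\infty$. When $\overline{\sigma}m_0<\underline{\sigma}$, define for $\overline{\sigma}m_0\le a\le\underline{\sigma}$ $$f_a(x)=m^{-1}\left(\frac{a}{\sigma(x)}\right),\quad x\in\mathbf{T};$$ for $a<\underline{\sigma}$ this is a $[0,\infty)$-valued function, and $f_{\underline{\sigma}}$ is a $[0,\infty]$-valued function. Viscosity solutions: for continuous $F:\mathbf{T}\times\mathbf{R}\to\mathbf{R}$ and $u\in C(\mathbf{T})$, let $D^+u(x)$ (resp. $D^-u(x)$) be the set of $\phi'(x)$ with $\phi\in C^1(\mathbf{T})$ such that $u-\phi$ attains its maximum (resp. minimum) over $\mathbf{T}$ at $x$. $u$ is a subsolution (resp. supersolution) of $F(x,u')=0$ in $\mathbf{T}$ if $F(\hat x,p)\le0$ for all $\hat x$ and $p\in D^+u(\hat x)$ (resp. $F(\hat x,p)\ge0$ for all $\hat x$ and $p\in D^-u(\hat x)$); it is a solution if it is both. The equation $H(x,u'+P)=a$ is understood with $F(x,p)=H(x,p+P)-a$. Cell problem: for given $P\in\mathbf{R}$, a solution of the cell problem $H(x,u'(x)+P)=a$ in $\mathbf{T}$ is a pair $(u,a)\in\mathrm{Lip}(\mathbf{T})\times\mathbf{R}$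 such that $u$ is a viscosity solution of this equation. If a solution exists, the constant $a$ is unique and is called the critical value. The solvability set $\mathcal{D}$ is the set of $P\in\mathbf{R}$ for which the cell problem admits a solution. *)

(* Defs.v *)
From HB Require Import structures.
From mathcomp Require Import all_boot all_order all_algebra.
From mathcomp Require Import all_classical all_reals all_analysis.

Set Implicit Arguments.
Unset Strict Implicit.
Unset Printing Implicit Defensive.

Import Order.TTheory GRing.Theory Num.Theory.
Import numFieldNormedType.Exports.

Local Open Scope classical_set_scope.
Local Open Scope ring_scope.

(* A function on the torus T = R/Z is a function R -> R of period 1; its range
   over R is its range over T, and maxima over T are maxima over R. *)

Definition C1_torus (R : realType) (phi : R -> R) : Prop :=
  [/\ periodic phi 1, (forall x, derivable phi x 1) & continuous (derive1 phi)].

Definition Lip_torus (R : realType) (u : R -> R) : Prop :=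
  periodic u 1 /\ [lipschitz u x | x in [set: R]].

(* D^+ u(x) and D^- u(x) *)
Definition superdifferential (R : realType) (u : R -> R) (x : R) : set R :=
  [set p | exists2 phi : R -> R, C1_torus phi /\ derive1 phi x = p &
           forall y, u y - phi y <= u x - phi x].

Definition subdifferential (R : realType) (u : R -> R) (x : R) : set R :=
  [set p | exists2 phi : R -> R, C1_torus phi /\ derive1 phi x = p &
           forall y, u x - phi x <= u y - phi y].

Definition viscosity_subsolution (R : realType) (F : R -> R -> R)
    (u : R -> R) : Prop :=
  forall x p, superdifferential u x p -> F x p <= 0.

Definition viscosity_supersolution (R : realType) (F : R -> R -> R)
    (u : R -> R) : Prop :=
  forall x p, subdifferential u x p -> 0 <= F x p.

Definition viscosity_solution (R : realType) (F : R -> R -> R)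
    (u : R -> R) : Prop :=
  viscosity_subsolution F u /\ viscosity_supersolution F u.

Definition cell_solution (R : realType) (H : R -> R -> R) (P : R)
    (u : R -> R) (a : R) : Prop :=
  Lip_torus u /\ viscosity_solution (fun x p => H x (p + P) - a) u.

Definition solvability_set (R : realType) (H : R -> R -> R) : set R :=
  [set P | exists u a, cell_solution H P u a].

(* Uniqueness of the critical value is not built in. *)
Definition is_critical_value (R : realType) (H : R -> R -> R) (P c : R) : Prop :=
  exists u, cell_solution H P u c.

(* sigma_max and sigma_min are attained when sigma is continuous and periodic. *)
Definition sigma_max (R : realType) (sigma : R -> R) : R := sup (range sigma).

Definition sigma_min (R : realType) (sigma : R -> R) : R := inf (range sigma).

(* Only the restriction of m to [0, +oo[ matters. *)
Definition hamiltonian (R : realType) (sigma m : R -> R) (x p : R) : R :=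
  sigma x * m `|p|.

(* The inverse of m : [0, +oo[ -> [m 0, 1[, extended by +oo at 1; the default 0
   is only used outside [m 0, 1]. *)
Definition m_inv (R : realType) (m : R -> R) (y : R) : \bar R :=
  if y == 1 then +oo%E else ('pinv_(fun=> 0) `[0, +oo[%classic m y)%:E.

Definition f_ (R : realType) (sigma m : R -> R) (a x : R) : \bar R :=
  m_inv m (a / sigma x).

(* Main.v *)
(** Write v(x) = u(x) + P x, so that the equation says |v'| = f_a in the
    viscosity sense. Touching points are dense and u is Lipschitz, which forces
    smax * m 0 <= a < smin. The inequality |v'| <= f_a integrates to |P| <= I a.
    If a > smax * m 0, then f_a > 0, so v has no local minimum and is therefore
    monotone by v(x + 1) = v(x) + P; then v' >= f_a (or v' <= - f_a) integrates
    to |P| >= I a. Conversely, if F' = f_a, then v = F or v = - F solves the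
    equation when |P| = I a; at the lowest level a = smax * m 0, the function f_a
    vanishes at a maximum point of sigma, and starting F there,
    v(x) = min_n (n P + |F(x) - n I a|) solves it for every |P| <= I a. Since I is
    continuous and increasing and tends to I smin by monotone convergence, the
    solvable P are those with |P| < I smin. *)

Require Import Defs.
From HB Require Import structures.
From mathcomp Require Import all_boot all_order all_algebra.
From mathcomp Require Import all_classical all_reals all_analysis.
From mathcomp Require Import measurable_realfun ring lra.

Import Order.TTheory GRing.Theory Num.Theory.
Import numFieldNormedType.Exports.

Local Open Scope classical_set_scope.
Local Open Scope ring_scope.

(** * Derivatives and one-sided comparison *)

(** The definitions test [u] with periodic functions that touch it globally, while the comparison
    arguments need an exponential, a parabola or a primitive of [f_a], which are not periodic and
    touch only locally. The necessary conditions are therefore proved with local test functions, and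
    a separate conversion makes these periodic.

    No almost-everywhere differentiability of [u] is used: integrating an inequality on [v'] means
    showing that [v] plus or minus a primitive of [f_a] is monotone, which is read off from the
    signs of its test slopes.

    A solution at a level [a] above [smax * m 0] satisfies [|P| = I a], one at the lowest level only
    [|P| <= I a]; strict monotonicity of [I] then makes the critical value unique. The condition
    [|P| < I smin], read in the extended reals, covers the integrable and the non-integrable case at
    once. *)

Lemma near_ballP {R : realType} (x : R) (P : R -> Prop) :
  (\forall y \near x, P y) <->
  exists2 d : R, 0 < d & forall y : R, `|y - x| < d -> P y.
Proof.
split=> [/nbhs_ballP[d /= d0 H]|[d d0 H]].
  by exists d => // y yx; apply: H; rewrite /ball/= distrC.
by apply/nbhs_ballP; exists d => //= y; rewrite /ball/= distrC => /H.
Qed.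

Lemma is_derive_continuous {R : realType} (f : R -> R) (x d : R) :
  is_derive x 1 f d -> {for x, continuous f}.
Proof. by move=> [df _]; apply: differentiable_continuous; apply/derivable1_diffP. Qed.

Lemma is_derive_near {R : realType} (f : R -> R) (x d e : R) :
  is_derive x 1 f d -> 0 < e ->
  \forall y \near x, `|f y - f x - d * (y - x)| <= e * `|y - x|.
Proof.
move=> [df <-] e0; apply/near_ballP.
have /cvgrPdist_lt/(_ e e0) : h^-1 *: (f (h *: 1 + x) - f x) @[h --> 0^'] -->
  'D_1 f x by exact: df.
move=> /nbhs_ballP[r /= r0 H]; exists r => // y yx.
have [->|neq] := eqVneq y x; first by rewrite !subrr mulr0 subrr normr0 mulr0.
have := H (y - x); rewrite /ball /= sub0r normrN subr_eq0 => /(_ yx neq).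
rewrite /GRing.scale /= mulr1 subrK => /ltW h.
have yx0 : y - x != 0 by rewrite subr_eq0.
rewrite -[X in X - _](mulVKf yx0) [_ * (y - x)]mulrC -mulrBr normrM mulrC.
by rewrite ler_wpM2r// distrC.
Qed.

Lemma is_derive_ge0_right {R : realType} (f : R -> R) (x d : R) :
  is_derive x 1 f d -> (\forall y \near x, x < y -> f x <= f y) -> 0 <= d.
Proof.
move=> fd /near_ballP[r r0 H]; rewrite leNgt; apply/negP => d0.
have e0 : 0 < - d / 2 by lra.
have /near_ballP[s s0 /(_ (x + Num.min r s / 2))] := is_derive_near _ _ _ _ fd e0.
have := H (x + Num.min r s / 2).
have : 0 < Num.min r s by rewrite lt_min r0.
have : Num.min r s <= r by rewrite ge_min lexx.
have : Num.min r s <= s by rewrite ge_min lexx orbT.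
move: (Num.min r s) => m ms mr m0.
have -> : x + m / 2 - x = m / 2 by ring.
rewrite gtr0_norm; last lra.
move=> /(_ ltac:(lra) ltac:(lra)) h /(_ ltac:(lra)); rewrite ler_norml => /andP[_].
nra.
Qed.

Lemma is_derive_comp {R : realType} (f g : R -> R) (x a b : R) :
  is_derive (g x) 1 f a -> is_derive x 1 g b ->
  is_derive x 1 (fun y => f (g y)) (a * b).
Proof. exact: is_derive1_comp. Qed.

Lemma is_deriveDf {R : realType} (f g : R -> R) (x a b : R) :
  is_derive x 1 f a -> is_derive x 1 g b ->
  is_derive x 1 (fun y => f y + g y) (a + b).
Proof. exact: is_deriveD. Qed.

Lemma is_deriveBf {R : realType} (f g : R -> R) (x a b : R) :
  is_derive x 1 f a -> is_derive x 1 g b ->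
  is_derive x 1 (fun y => f y - g y) (a - b).
Proof. exact: is_deriveB. Qed.

Lemma is_deriveNf {R : realType} (f : R -> R) (x a : R) :
  is_derive x 1 f a -> is_derive x 1 (fun y => - f y) (- a).
Proof. exact: is_deriveN. Qed.

Lemma is_deriveMlf {R : realType} (f : R -> R) (k x a : R) :
  is_derive x 1 f a -> is_derive x 1 (fun y => k * f y) (k * a).
Proof. exact: is_deriveZ. Qed.

Lemma is_derive_linear {R : realType} (k x : R) :
  is_derive x 1 (fun y : R => k * y) k.
Proof.
rewrite -[X in is_derive _ _ _ X]mulr1.
exact: (is_deriveMlf id k x 1 (is_derive_id _ _)).
Qed.

Lemma is_derive_reflect {R : realType} (f : R -> R) (x a : R) :
  is_derive (- x) 1 f a -> is_derive x 1 (fun y => f (- y)) (- a).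
Proof.
move=> fa; rewrite -mulrN1; apply: is_derive_comp fa _.
Qed.

Lemma is_derive_le0_right {R : realType} (f : R -> R) (x d : R) :
  is_derive x 1 f d -> (\forall y \near x, x < y -> f y <= f x) -> d <= 0.
Proof.
move=> /is_deriveNf fd H; rewrite -oppr_ge0; apply: is_derive_ge0_right fd _.
by apply: filterS H => y H /H; rewrite lerN2.
Qed.

Lemma is_derive_le0_left {R : realType} (f : R -> R) (x d : R) :
  is_derive x 1 f d -> (\forall y \near x, y < x -> f x <= f y) -> d <= 0.
Proof.
rewrite -[x]opprK => /is_derive_reflect fd /near_ballP[r r0 H].
rewrite -oppr_ge0; apply: is_derive_ge0_right fd _.
apply/near_ballP; exists r => // y yx xy; apply: H; rewrite ?ltrN2//.
by rewrite -opprD normrN.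
Qed.

Lemma is_derive_ge0_left {R : realType} (f : R -> R) (x d : R) :
  is_derive x 1 f d -> (\forall y \near x, y < x -> f y <= f x) -> 0 <= d.
Proof.
move=> /is_deriveNf fd H; rewrite -oppr_le0; apply: is_derive_le0_left fd _.
by apply: filterS H => y H /H; rewrite lerN2.
Qed.

Lemma is_derive_max {R : realType} (f : R -> R) (x d : R) :
  is_derive x 1 f d -> (\forall y \near x, f y <= f x) -> d = 0.
Proof.
move=> fd H; apply/eqP; rewrite eq_le; apply/andP; split.
  by apply: is_derive_le0_right fd _; apply: filterS H.
by apply: is_derive_ge0_left fd _; apply: filterS H.
Qed.

Lemma is_derive_mean_value {R : realType} (f df : R -> R) (a b : R) :
  (forall x : R, is_derive x 1 f (df x)) -> a <= b ->
  exists2 c, a <= c <= b & f b - f a = df c * (b - a).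
Proof.
move=> fd ab; have [|c] := MVT_segment ab (fun x _ => fd x).
  by apply: continuous_subspaceT => x; exact: is_derive_continuous (fd x).
by rewrite in_itv /= => cab; exists c.
Qed.

Lemma is_derive_ge0_le {R : realType} (f df : R -> R) (a b : R) :
  (forall x : R, is_derive x 1 f (df x)) -> a <= b ->
  (forall x, a <= x <= b -> 0 <= df x) -> f a <= f b.
Proof.
move=> fd ab df0; have [c /df0 c0 fE] := is_derive_mean_value _ _ _ _ fd ab.
by rewrite -subr_ge0 fE mulr_ge0// subr_ge0.
Qed.

Lemma periodic_int {R : realType} (V : zmodType) (u : R -> V) (n : int) (x : R) :
  periodic u 1 -> u (x + n%:~R) = u x.
Proof.
move=> pu; case: n => n; first by rewrite -pmulrn periodicn.
by rewrite NegzE -[in RHS](subrK n.+1%:R x) mulrNz -pmulrn periodicn.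
Qed.

Lemma periodic_max {R : realType} (u : R -> R) :
  periodic u 1 -> continuous u -> exists x, forall y, u y <= u x.
Proof.
move=> pu cu.
have [c _ cmax] := EVT_max ler01 (continuous_subspaceT cu : {within `[0, 1], continuous u}).
exists c => y; rewrite -(periodic_int _ u (- Num.floor y) y pu); apply: cmax.
have /andP[] := floor_itv y.
by rewrite intrD in_itv /= mulrNz => y1 y2; apply/andP; split; lra.
Qed.

Lemma periodic_min {R : realType} (u : R -> R) :
  periodic u 1 -> continuous u -> exists x, forall y, u x <= u y.
Proof.
move=> pu cu; have [|x|x H] := periodic_max (fun x => - u x).
- by move=> x; rewrite pu.
- by apply: cvgN; exact: cu.
- by exists x => y; rewrite -lerN2.
Qed.

Lemma periodic_bounded {R : realType} (u : R -> R) :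
  periodic u 1 -> continuous u -> exists B : R, forall y, `|u y| <= B.
Proof.
move=> pu cu; have [a amax] := periodic_max _ pu cu.
have [b bmin] := periodic_min _ pu cu.
exists (`|u a| + `|u b|) => y; have := amax y; have := bmin y.
have := ler_norm (u a); have := ler_norm (- u b); rewrite normrN.
have := normr_ge0 (u a); have := normr_ge0 (u b).
by rewrite ler_norml => *; apply/andP; split; lra.
Qed.

Lemma interior_max {R : realType} (h : R -> R) (a c b : R) :
  continuous h -> a < c -> c < b -> h a < h c -> h b < h c ->
  exists2 x, a < x < b & \forall y \near x, h y <= h x.
Proof.
move=> ch ac cb hac hbc; have ab : a <= b by lra.
have [x xab xmax] := EVT_max ab (continuous_subspaceT ch : {within `[a, b], continuous h}).
have hcx : h c <= h x by apply: xmax; rewrite in_itv /=; lra.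
have xab' : x \in `]a, b[.
  move: xab; rewrite !in_itv /= !lt_neqAle => /andP[-> ->]; rewrite !andbT.
  apply/andP; split; apply/eqP => E; move: hcx.
    by rewrite -E leNgt hac.
  by rewrite E leNgt hbc.
exists x; first by move: xab'; rewrite in_itv.
apply: filterS (near_in_itvoo xab') => y; rewrite in_itv /= => /andP[ya yb].
by apply: xmax; rewrite in_itv /= !ltW.
Qed.

(** * Local test functions *)

(** Not restricted to periodic functions, unlike [C1_torus]. The derivative is an argument so that
    the closure lemmas below compute it along with the function. *)
Definition is_C1 {R : realType} (phi dphi : R -> R) : Prop :=
  (forall x : R, is_derive x 1 phi (dphi x)) /\ continuous dphi.

Definition touch_above {R : realType} (u phi : R -> R) (x : R) : Prop :=
  \forall y \near x, u y - phi y <= u x - phi x.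

Definition touch_below {R : realType} (u phi : R -> R) (x : R) : Prop :=
  \forall y \near x, u x - phi x <= u y - phi y.

Lemma is_C1_continuous {R : realType} (phi dphi : R -> R) :
  is_C1 phi dphi -> continuous phi.
Proof. by move=> [H _] x; exact: is_derive_continuous (H x). Qed.

Lemma is_C1D {R : realType} (f g df dg : R -> R) : is_C1 f df -> is_C1 g dg ->
  is_C1 (fun x => f x + g x) (fun x => df x + dg x).
Proof.
move=> [fd cf] [gd cg]; split=> x; first exact: is_deriveDf.
by apply: cvgD; [exact: cf|exact: cg].
Qed.

Lemma is_C1N {R : realType} (f df : R -> R) : is_C1 f df ->
  is_C1 (fun x => - f x) (fun x => - df x).
Proof.
by move=> [fd cf]; split=> x; [exact: is_deriveNf|apply: cvgN; exact: cf].
Qed.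

Lemma is_C1Ml {R : realType} (k : R) (f df : R -> R) : is_C1 f df ->
  is_C1 (fun x => k * f x) (fun x => k * df x).
Proof.
move=> [fd cf]; split=> x; first exact: is_deriveMlf.
by apply: cvgM; [exact: cvg_cst|exact: cf].
Qed.

Lemma is_C1_comp {R : realType} (f g df dg : R -> R) : is_C1 f df -> is_C1 g dg ->
  is_C1 (fun x => f (g x)) (fun x => df (g x) * dg x).
Proof.
move=> Hf Hg; have [fd cf] := Hf; have [gd cg] := Hg.
split=> x; first exact: is_derive_comp.
apply: cvgM; last exact: cg.
by apply: (@continuous_comp _ _ _ g df); [exact: is_C1_continuous Hg x|exact: cf].
Qed.

Lemma is_C1_cst {R : realType} (k : R) : is_C1 (fun=> k) (fun=> 0).
Proof. by split=> x; [exact: is_derive_cst|exact: cvg_cst]. Qed.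

Lemma is_C1_linear {R : realType} (k : R) : is_C1 (fun x : R => k * x) (fun=> k).
Proof. by split=> x; [exact: is_derive_linear|exact: cvg_cst]. Qed.

Lemma is_C1_affine {R : realType} (k x0 : R) :
  is_C1 (fun x : R => k * (x - x0)) (fun=> k).
Proof.
split=> x; last exact: cvg_cst.
rewrite -[X in is_derive _ _ _ X]addr0.
have -> : (fun y => k * (y - x0)) = (fun y => k * y + - (k * x0)).
  by apply/funext => y; ring.
apply: is_deriveDf; exact: is_derive_linear.
Qed.

Lemma is_C1_reflect {R : realType} (f df : R -> R) : is_C1 f df ->
  is_C1 (fun x => f (- x)) (fun x => - df (- x)).
Proof.
move=> [fd cf]; split=> x; first exact: is_derive_reflect.
by apply: cvgN; apply: (@continuous_comp _ _ _ -%R df); [exact: opp_continuous|exact: cf].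
Qed.

Lemma touch_belowN {R : realType} (u phi : R -> R) (x : R) :
  touch_below u phi x -> touch_above (fun y => - u y) (fun y => - phi y) x.
Proof. by move=> H; apply: filterS H => y H /=; lra. Qed.

Lemma touch_aboveN {R : realType} (u phi : R -> R) (x : R) :
  touch_above u phi x -> touch_below (fun y => - u y) (fun y => - phi y) x.
Proof. by move=> H; apply: filterS H => y H /=; lra. Qed.

Lemma touch_above_reflect {R : realType} (u phi : R -> R) (x : R) :
  touch_above u phi x ->
  touch_above (fun y => u (- y)) (fun y => phi (- y)) (- x).
Proof.
move=> /near_ballP[d d0 H]; apply/near_ballP; exists d => // y yx.
by rewrite opprK; apply: H; rewrite (_ : - y - x = - (y - - x)) ?normrN//; ring.
Qed.

(* The exponential barrier is negligible up to [y] but pushes the maximum of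
   [w - phi] away from the right end of the interval. *)
Lemma touch_above_nonincreasing {R : realType} (w : R -> R) :
  continuous w ->
  (forall phi dphi x, is_C1 phi dphi -> touch_above w phi x -> dphi x <= 0) ->
  forall x y, x <= y -> w y <= w x.
Proof.
move=> cw H x y; rewrite le_eqVlt => /predU1P[->//|xy].
rewrite leNgt; apply/negP => wxy.
(* At [y] the barrier costs [e], half of the gap, so the value there stays above the one at [x]. As
   [expR K >= 1 + K], this [K] makes the cost at [y + 1] exceed any growth of [w] from [y] to
   [y + 1]. *)
pose e := (w y - w x) / 2; have e0 : 0 < e by rewrite /e; lra.
pose K := `|w (y + 1) - w y| / e + 1.
have K0 : 0 < K by rewrite /K ltr_wpDl// divr_ge0// ltW.
have C1 : is_C1 (fun t => e * expR (K * (t - y)))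
               (fun t => e * (expR (K * (t - y)) * K)).
  apply/is_C1Ml/is_C1_comp; last exact: is_C1_affine.
  by split; [exact: is_derive_expR|exact: continuous_expR].
have [|||||z _ zmax] := interior_max (fun t => w t - e * expR (K * (t - y))) x y (y + 1).
- by move=> t; apply: cvgB; [exact: cw|exact: is_C1_continuous C1 t].
- by [].
- by rewrite ltrDl.
- rewrite subrr mulr0 expR0 mulr1.
  have : 0 < e * expR (K * (x - y)) by rewrite mulr_gt0// expR_gt0.
  by rewrite /e; lra.
- rewrite subrr mulr0 expR0 mulr1 addrAC subrr add0r mulr1.
  have : e * (1 + K) <= e * expR K by rewrite ler_pM2l// expR_ge1Dx.
  rewrite /K !mulrDr mulrCA divff ?gt_eqF// mulr1.
  have := ler_norm (w (y + 1) - w y); lra.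
have := H _ _ z C1 zmax; apply/negP; rewrite -ltNge.
by rewrite pmulr_rgt0// mulr_gt0// expR_gt0.
Qed.

(** Passing to [t |-> - w (- t)] exchanges touching from above and from below, and preserves both
    slopes and the direction of monotonicity. *)
Lemma touch_below_nonincreasing {R : realType} (w : R -> R) :
  continuous w ->
  (forall phi dphi x, is_C1 phi dphi -> touch_below w phi x -> dphi x <= 0) ->
  forall x y, x <= y -> w y <= w x.
Proof.
move=> cw H x y xy.
rewrite -[w y]opprK -[w x]opprK lerN2 -[x]opprK -[y]opprK.
apply: (touch_above_nonincreasing (fun t => - w (- t))); last by rewrite lerN2.
  move=> t; apply: cvgN; apply: (@continuous_comp _ _ _ -%R w); last exact: cw.
  exact: opp_continuous.
move=> phi dphi t C1 /touch_above_reflect/touch_aboveN.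
under [X in touch_below X _ _]eq_fun do rewrite !opprK.
move=> /(H _ _ _ (is_C1N _ _ (is_C1_reflect _ _ C1))).
by rewrite !opprK.
Qed.

Lemma touch_above_nondecreasing {R : realType} (w : R -> R) :
  continuous w ->
  (forall phi dphi x, is_C1 phi dphi -> touch_above w phi x -> 0 <= dphi x) ->
  forall x y, x <= y -> w x <= w y.
Proof.
move=> cw H x y xy; rewrite -lerN2.
apply: (touch_below_nonincreasing (fun t => - w t)) xy.
  by move=> t; apply: cvgN; exact: cw.
move=> phi dphi t C1 /touch_belowN.
under [X in touch_above X _ _]eq_fun do rewrite opprK.
by move=> /(H _ _ _ (is_C1N _ _ C1)); rewrite oppr_ge0.
Qed.

Lemma touch_below_nondecreasing {R : realType} (w : R -> R) :
  continuous w ->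
  (forall phi dphi x, is_C1 phi dphi -> touch_below w phi x -> 0 <= dphi x) ->
  forall x y, x <= y -> w x <= w y.
Proof.
move=> cw H x y xy; rewrite -lerN2.
apply: (touch_above_nonincreasing (fun t => - w t)) xy.
  by move=> t; apply: cvgN; exact: cw.
move=> phi dphi t C1 /touch_aboveN.
under [X in touch_below X _ _]eq_fun do rewrite opprK.
by move=> /(H _ _ _ (is_C1N _ _ C1)); rewrite oppr_ge0.
Qed.

(** Density of touching points: subtracting a steep parabola centred at [x0] forces a local maximum
    close to [x0]. *)
Lemma touch_above_exists {R : realType} (u : R -> R) (x0 d : R) :
  continuous u -> 0 < d ->
  exists x phi dphi, [/\ `|x - x0| < d, is_C1 phi dphi & touch_above u phi x].
Proof.
move=> cu d0; pose r := d / 2; have r0 : 0 < r by rewrite /r; lra.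
(* The penalty [K * r ^+ 2] at both ends exceeds the possible gain of [u] over [u x0]. *)
pose K := (`|u (x0 - r) - u x0| + `|u (x0 + r) - u x0| + 1) / r ^+ 2.
have KE : K * (r * r) = `|u (x0 - r) - u x0| + `|u (x0 + r) - u x0| + 1.
  by rewrite -expr2 /K divfK// sqrf_eq0 gt_eqF.
(* The factor [1] lets the inner function match [is_C1_affine]. *)
have C1 : is_C1 (fun t => K * ((1 * (t - x0)) ^+ 2))
               (fun t => K * ((1 * (t - x0)) *+ 2 * 1)).
  apply/is_C1Ml/(is_C1_comp (fun s => s ^+ 2) _ (fun s => s *+ 2)); last exact: is_C1_affine.
  split=> s; last by apply: cvgMn; exact: cvg_id.
  rewrite -[X in is_derive _ _ _ X]mulr1 mulr2n mulrDl.
  exact: (is_deriveM (is_derive_id _ _) (is_derive_id _ _)).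
have [|||||x xr xmax] :=
    interior_max (fun t => u t - K * ((1 * (t - x0)) ^+ 2)) (x0 - r) x0 (x0 + r).
- by move=> t; apply: cvgB; [exact: cu|exact: is_C1_continuous C1 t].
- by lra.
- by lra.
- rewrite subrr mulr0 expr0n/= mulr0 subr0 mul1r addrAC subrr sub0r sqrrN expr2 KE.
  have := ler_norm (u (x0 - r) - u x0); have := normr_ge0 (u (x0 + r) - u x0); lra.
- rewrite subrr mulr0 expr0n/= mulr0 subr0 mul1r addrAC subrr add0r expr2 KE.
  have := ler_norm (u (x0 + r) - u x0); have := normr_ge0 (u (x0 - r) - u x0); lra.
exists x; eexists; eexists; split; [|exact: C1|exact: xmax].
by rewrite ltr_norml; move: xr; rewrite /r => /andP[? ?]; apply/andP; split; lra.
Qed.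

Lemma touch_below_exists {R : realType} (u : R -> R) (x0 d : R) :
  continuous u -> 0 < d ->
  exists x phi dphi, [/\ `|x - x0| < d, is_C1 phi dphi & touch_below u phi x].
Proof.
move=> cu d0.
have [|x [phi [dphi [xd C1 T]]]] := touch_above_exists (fun t => - u t) x0 d _ d0.
  by move=> t; apply: cvgN; exact: cu.
exists x; eexists; eexists; split; [exact: xd|exact: is_C1N C1|].
move/touch_aboveN: T.
by under [X in touch_below X _ _]eq_fun do rewrite opprK.
Qed.

Lemma is_derive_lipschitz {R : realType} (f df : R -> R) (a b B x y : R) :
  (forall x : R, is_derive x 1 f (df x)) ->
  (forall x, a <= x <= b -> `|df x| <= B) ->
  a <= x <= b -> a <= y <= b -> `|f x - f y| <= B * `|x - y|.
Proof.
move=> fd dfB; wlog xy : x y / y <= x => [hwlog xab yab|].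
  by case: (leP y x) => [/hwlog|/ltW/hwlog]; last rewrite distrC [`|x - y|]distrC; exact.
move=> /andP[ax xb] /andP[ay yb].
have [c /andP[yc cx] ->] := is_derive_mean_value _ _ _ _ fd xy.
by rewrite normrM ler_wpM2r// dfB// (le_trans ay)//= (le_trans cx).
Qed.

Lemma continuous_itv_bounded {R : realType} (f : R -> R) (a b : R) :
  continuous f -> exists2 B : R, 0 <= B & forall x, a <= x <= b -> `|f x| <= B.
Proof.
move=> cf; have [ab|ab] := leP a b; last first.
  by exists 0 => // x /andP[ax xb]; move: ab; rewrite ltNge (le_trans ax).
have cnf : {within `[a, b], continuous (fun x => `|f x|)}.
  by apply: continuous_subspaceT => x; apply: cvg_norm; exact: cf.
have [c _ H] := EVT_max ab cnf.
by exists `|f c| => // x xab; apply: H; rewrite in_itv.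
Qed.

(** * From local to periodic test functions *)

(** Compares the error of the reparametrization by [sin] with the penalty [1 - cos]. For
    [0 <= t <= pi / 2], the function [t - sin t + cos t] is nonincreasing, because [sin + cos >= 1]
    where both are nonnegative. *)
Lemma sub_sin_le {R : realType} (t : R) :
  `|t| <= pi / 2 -> `|t - sin t| <= 1 - cos t.
Proof.
wlog t0 : t / 0 <= t => [hwlog|].
  case: (leP 0 t) => [/hwlog//|t0].
  have := hwlog (- t); rewrite sinN cosN -opprD !normrN; apply.
  by rewrite oppr_ge0 ltW.
rewrite ger0_norm// => tpi.
have dsub (x : R) : is_derive x 1 (fun t : R => t - sin t) (1 - cos x).
  by apply: is_deriveBf; exact: is_derive_sin.
have dcos (x : R) : is_derive x 1 (fun t : R => t - sin t + cos t) (1 - cos x + - sin x).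
  by apply: is_deriveDf; exact: is_derive_cos.
have sub0 : 0 <= t - sin t.
  have := is_derive_ge0_le _ _ 0 t dsub t0; rewrite sin0 subr0; apply.
  by move=> x _; rewrite subr_ge0 cos_le1.
rewrite ger0_norm//.
have := is_derive_ge0_le (fun t => - (t - sin t + cos t)) _ 0 t _ t0.
move=> /(_ _ (fun x => is_deriveNf _ _ _ (dcos x))).
rewrite sin0 cos0 subrr add0r => H.
suff : -1 <= - (t - sin t + cos t) by lra.
apply: H => x /andP[x0 xt].
have xpi : - (pi / 2) <= x <= pi / 2 by apply/andP; split; lra.
have c0 := cos_ge0_pihalf xpi.
have s0 : 0 <= sin x by apply: sin_ge0_pi; apply/andP; split; lra.
have := cos2Dsin2 x; rewrite !expr2; nra.
Qed.

Lemma cos_le_cos {R : realType} (a b : R) : 0 <= a -> a <= `|b| -> `|b| <= pi ->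
  cos b <= cos a.
Proof.
move=> a0 ab bpi.
have -> : cos b = cos `|b| by case: ger0P => // _; rewrite cosN.
have apos : a \in `[0, pi] by rewrite in_itv /= a0 (le_trans ab).
have bpos : `|b| \in `[0, pi] by rewrite in_itv /= normr_ge0.
by rewrite leNgt (ltr_cos bpos apos) -leNgt.
Qed.

Lemma is_C1_torus {R : realType} (phi dphi : R -> R) :
  is_C1 phi dphi -> periodic phi 1 -> C1_torus phi /\ derive1 phi = dphi.
Proof.
move=> [fd cf] pphi.
have E : derive1 phi = dphi.
  by apply/funext => x; rewrite derive1E; have [] := fd x.
by split=> //; split=> //; rewrite E.
Qed.

(* A test function touching at [x] is made periodic by reparametrizing it with
   [sin]; the error, of second order, is absorbed by the periodic penalty
   [1 - cos], which also takes care of the points far from [x]. *)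
Lemma touch_above_superdifferential {R : realType} (u phi dphi : R -> R) (x : R) :
  periodic u 1 -> continuous u -> is_C1 phi dphi -> touch_above u phi x ->
  superdifferential u x (dphi x).
Proof.
move=> pu cu C1 /near_ballP[d d0 T].
pose c : R := pi *+ 2.
have pi2 : 2 <= pi :> R by exact: pi_ge2.
have c1 : 1 <= c by rewrite /c mulr2n; lra.
have c0 : 0 < c by lra.
have [B Bu] := periodic_bounded _ pu cu.
have B0 : 0 <= B := le_trans (normr_ge0 _) (Bu 0).
have [B1 B10 Bphi] := continuous_itv_bounded dphi (x - 1) (x + 1) C1.2.
(* With [r <= 1/4], [|h| < r] gives [|c * h| <= pi / 2], the range of [sub_sin_le]. *)
pose r := Num.min d (1/4).
have r0 : 0 < r by rewrite lt_min d0/=; lra.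
have rd : r <= d by rewrite ge_min lexx.
have r4 : r <= 1/4 by rewrite ge_min lexx orbT.
pose q0 := 1 - cos (c * r).
have q00 : 0 < q0.
  rewrite subr_gt0 -cos0.
  have m0 : (0 : R) \in `[0, pi] by rewrite in_itv /= lexx pi_ge0.
  have mr : c * r \in `[0, pi].
    rewrite in_itv /= mulr_ge0 ?(ltW c0) ?(ltW r0)//= /c mulr2n; nra.
  by rewrite (ltr_cos m0 mr) mulr_gt0.
(* The term [B1] pays for the reparametrization error when [|h| < r]. Farther away the penalty is at
   least [q0], and the second term pays for the oscillation [2 * B] of [u] and [B1] of [phi]. *)
pose K := B1 + (2 * B + B1) / q0.
(* A 1-periodic substitute for [h], with value [0] and slope [1] at [0], so that [Phi] keeps the
   slope of [phi] at [x]. *)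
pose s h := c^-1 * sin (c * h).
pose Phi y := phi (x + s (y - x)) + K * (1 + - cos (c * (y - x))).
have [dPhi [CPhi EPhi]] : exists dPhi, is_C1 Phi dPhi /\ dPhi x = dphi x.
  have cs : is_C1 sin (@cos R).
    by split; [exact: is_derive_sin|exact: continuous_cos].
  have cc : is_C1 cos (fun x : R => - sin x).
    split; first exact: is_derive_cos.
    by move=> t; apply: cvgN; exact: continuous_sin.
  eexists; split.
    apply: is_C1D.
      apply: (is_C1_comp phi _ _ _ C1).
      apply: is_C1D; first exact: is_C1_cst.
      apply: is_C1Ml.
      apply: (is_C1_comp sin (fun y => c * (y - x)) _ _ cs); exact: is_C1_affine.
    apply: is_C1Ml.
    apply: is_C1D; first exact: is_C1_cst.
    apply: is_C1N.
    apply: (is_C1_comp cos (fun y => c * (y - x)) _ _ cc); exact: is_C1_affine.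
  rewrite /= /s subrr mulr0 sin0 cos0 mulr0 !addr0 mul1r mulVf ?gt_eqF//.
  by rewrite oppr0 mul0r subr0 mulr0 addr0 add0r mulr1.
have pPhi : periodic Phi 1.
  move=> y; rewrite /Phi /s addrAC mulrDr mulr1.
  by rewrite /c sinD2pi cosD2pi.
have [CT D_E] := is_C1_torus _ _ CPhi pPhi.
exists Phi; first by rewrite D_E.
move=> y.
have PhiE : Phi x = phi x by rewrite /Phi /s subrr mulr0 sin0 cos0 mulr0 subrr mulr0 !addr0.
(* The nearest integer to [y - x]: by periodicity only [|h| <= 1/2] is left, where [|c * h| <= pi]
   and [cos] is monotone in [|h|]. *)
pose n := Num.floor (y - x + 1/2).
pose h := y - x - n%:~R.
have yE : y = x + h + n%:~R by rewrite /h; ring.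
rewrite yE (periodic_int _ u n (x + h) pu) (periodic_int _ Phi n (x + h) pPhi) PhiE.
have h2 : `|h| <= 1/2.
  have /andP[] := floor_itv (y - x + 1/2); rewrite intrD -/n /h => n1 n2.
  by rewrite ler_norml; apply/andP; split; lra.
have -> : Phi (x + h) = phi (x + s h) + K * (1 - cos (c * h)).
  by rewrite /Phi (_ : x + h - x = h)//; ring.
have s1 : `|s h| <= 1.
  rewrite /s normrM gtr0_norm ?invr_gt0// ler_pdivrMl// mulr1.
  by rewrite (le_trans _ c1)// ler_norml sin_geN1 sin_le1.
have sI : x - 1 <= x + s h <= x + 1.
  by move: s1; rewrite ler_norml => /andP[? ?]; apply/andP; split; lra.
have hI : x - 1 <= x + h <= x + 1.
  by move: h2; rewrite ler_norml => /andP[? ?]; apply/andP; split; lra.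
have xI : x - 1 <= x <= x + 1 by apply/andP; split; lra.
have q1 : 0 <= 1 - cos (c * h) by rewrite subr_ge0 cos_le1.
have f0 : 0 <= (2 * B + B1) / q0 by rewrite divr_ge0 ?(ltW q00)//; lra.
have [hr|hr] := ltP `|h| r.
  have := T (x + h); rewrite (_ : x + h - x = h); last by ring.
  move=> /(_ (lt_le_trans hr rd)) Th.
  have := is_derive_lipschitz _ _ _ _ _ _ _ C1.1 Bphi hI sI.
  rewrite (_ : x + h - (x + s h) = c^-1 * (c * h - sin (c * h))); last first.
    by rewrite /s; move: (c) c0 => k k0; field; rewrite gt_eqF.
  rewrite normrM [`|c^-1|]gtr0_norm ?invr_gt0// => L.
  have Q : `|c * h - sin (c * h)| <= 1 - cos (c * h).
    apply: sub_sin_le; rewrite normrM gtr0_norm// /c mulr2n; nra.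
  have Q' : c^-1 * `|c * h - sin (c * h)| <= 1 - cos (c * h).
    rewrite ler_pdivrMl//; nra.
  have := ler_norm (phi (x + h) - phi (x + s h)).
  have : B1 * (c^-1 * `|c * h - sin (c * h)|) <= B1 * (1 - cos (c * h)).
    by rewrite ler_wpM2l.
  have : 0 <= (2 * B + B1) / q0 * (1 - cos (c * h)) by rewrite mulr_ge0.
  rewrite /K [(B1 + _) * _]mulrDl; lra.
have Q : q0 <= 1 - cos (c * h).
  rewrite lerD2l lerN2; apply: cos_le_cos.
  - by rewrite mulr_ge0 ?(ltW c0) ?(ltW r0).
  - by rewrite normrM (gtr0_norm c0) ler_pM2l.
  - rewrite normrM (gtr0_norm c0) /c mulr2n; nra.
have : (2 * B + B1) / q0 * q0 <= (2 * B + B1) / q0 * (1 - cos (c * h)).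
  by rewrite ler_wpM2l.
rewrite divfK ?gt_eqF// => Q'.
have := is_derive_lipschitz _ _ _ _ _ _ _ C1.1 Bphi sI xI.
rewrite (_ : x + s h - x = s h); last by ring.
rewrite distrC => L.
have := ler_norm (phi x - phi (x + s h)).
have : B1 * `|s h| <= B1 by rewrite ler_piMr.
have : 0 <= B1 * (1 - cos (c * h)) by rewrite mulr_ge0.
have := ler_norm (u (x + h)); have := Bu (x + h).
have := ler_norm (- u x); rewrite normrN; have := Bu x.
rewrite /K [(B1 + _) * _]mulrDl; lra.
Qed.

Lemma subdifferentialN {R : realType} (u : R -> R) (x p : R) :
  superdifferential (fun y => - u y) x p -> subdifferential u x (- p).
Proof.
move=> [phi [[pphi dphi cphi] <-] H].
have C1 : is_C1 phi (derive1 phi).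
  split=> // y; apply: DeriveDef; [exact: dphi|by rewrite derive1E].
have [|CT D_E] := is_C1_torus _ _ (is_C1N _ _ C1).
  by move=> y; rewrite pphi.
exists (fun y => - phi y); first by rewrite D_E.
by move=> y; have := H y; lra.
Qed.

Lemma touch_below_subdifferential {R : realType} (u phi dphi : R -> R) (x : R) :
  periodic u 1 -> continuous u -> is_C1 phi dphi -> touch_below u phi x ->
  subdifferential u x (dphi x).
Proof.
move=> pu cu C1 /touch_belowN T; rewrite -[dphi x]opprK.
apply: subdifferentialN; apply: touch_above_superdifferential (is_C1N _ _ C1) T.
  by move=> y; rewrite pu.
by move=> y; apply: cvgN; exact: cu.
Qed.

(** * The eikonal equation |u' + P| = f on the torus *)

Lemma superdifferential_is_derive {R : realType} (u : R -> R) (x p : R) :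
  superdifferential u x p ->
  exists2 phi, is_derive x 1 phi p & forall y, u y - phi y <= u x - phi x.
Proof.
move=> [phi [[pphi dphi cphi] <-] H]; exists phi => //.
by apply: DeriveDef; [exact: dphi|rewrite derive1E].
Qed.

Lemma subdifferential_is_derive {R : realType} (u : R -> R) (x p : R) :
  subdifferential u x p ->
  exists2 phi, is_derive x 1 phi p & forall y, u x - phi x <= u y - phi y.
Proof.
move=> [phi [[pphi dphi cphi] <-] H]; exists phi => //.
by apply: DeriveDef; [exact: dphi|rewrite derive1E].
Qed.

Lemma continuousD_linear {R : realType} (u : R -> R) (P : R) :
  continuous u -> continuous (fun x => u x + P * x).
Proof.
move=> cu x; apply: cvgD; first exact: cu.
exact: is_derive_continuous (is_derive_linear P x).
Qed.

(** Let [v x = u x + P * x]. A slope [q] touching [v + F] from above satisfies [|q - f| <= f], so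
    [q >= 0]; likewise [q <= 0] for [v - F]. The resulting monotonicity is evaluated between [0] and
    [1], where [v] grows by [P]. *)
Lemma subsolution_bound {R : realType} (u F f : R -> R) (P : R) :
  periodic u 1 -> continuous u -> is_C1 F f ->
  (forall x p, superdifferential u x p -> `|p + P| <= f x) ->
  `|P| <= F 1 - F 0.
Proof.
move=> pu cu CF H.
have u10 : u 1 = u 0 by rewrite -[1]add0r pu.
have cF := is_C1_continuous _ _ CF.
have cv := continuousD_linear _ P cu.
have CP := is_C1N _ _ (is_C1_linear P).
rewrite ler_norml; apply/andP; split.
  have : u 0 + P * 0 + F 0 <= u 1 + P * 1 + F 1.
    apply: (touch_above_nondecreasing (fun x => u x + P * x + F x)) ler01.
      by move=> x; apply: cvgD; [exact: cv|exact: cF].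
    move=> phi dphi x Cphi T.
    have C := is_C1D _ _ _ _ (is_C1D _ _ _ _ Cphi CP) (is_C1N _ _ CF).
    have T' : touch_above u (fun y => phi y + - (P * y) + - F y) x.
      by apply: filterS T => y /=; lra.
    have /H := touch_above_superdifferential _ _ _ _ pu cu C T'.
    by rewrite ler_norml => /andP[]; lra.
  by rewrite u10; lra.
have : u 1 + P * 1 - F 1 <= u 0 + P * 0 - F 0.
  apply: (touch_above_nonincreasing (fun x => u x + P * x - F x)) ler01.
    by move=> x; apply: cvgB; [exact: cv|exact: cF].
  move=> phi dphi x Cphi T.
  have C := is_C1D _ _ _ _ (is_C1D _ _ _ _ Cphi CP) CF.
  have T' : touch_above u (fun y => phi y + - (P * y) + F y) x.
    by apply: filterS T => y /=; lra.
  have /H := touch_above_superdifferential _ _ _ _ pu cu C T'.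
  by rewrite ler_norml => /andP[]; lra.
by rewrite u10; lra.
Qed.

(* Where the gradient cannot vanish, [u + P x] has no local minimum, so that it
   is monotone in the direction given by the sign of [P]. *)
Lemma supersolution_bound {R : realType} (u F f : R -> R) (P : R) :
  periodic u 1 -> continuous u -> is_C1 F f -> (forall x, 0 < f x) ->
  (forall x p, subdifferential u x p -> f x <= `|p + P|) ->
  F 1 - F 0 <= `|P|.
Proof.
move=> pu cu CF f0 H.
have u10 : u 1 = u 0 by rewrite -[1]add0r pu.
have cF := is_C1_continuous _ _ CF.
have cv := continuousD_linear _ P cu.
have CP := is_C1N _ _ (is_C1_linear P).
have touch phi dphi x : is_C1 phi dphi ->
    touch_below (fun y => u y + P * y) phi x -> f x <= `|dphi x|.
  move=> Cphi T; have C := is_C1D _ _ _ _ Cphi CP.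
  have T' : touch_below u (fun y => phi y + - (P * y)) x.
    by apply: filterS T => y /=; lra.
  have /H := touch_below_subdifferential _ _ _ _ pu cu C T'.
  by rewrite subrK.
have nomin x : ~ \forall y \near x, u x + P * x <= u y + P * y.
  move=> T; suff : f x <= `|0 : R| by rewrite normr0 leNgt f0.
  apply: (touch _ _ x (is_C1_cst 0)).
  by apply: filterS T => y; rewrite !subr0.
have nodip a c b : a < c -> c < b ->
    u c + P * c < u a + P * a -> u c + P * c < u b + P * b -> False.
  move=> ac cb ca cb'.
  have [|||||x _ T] := interior_max (fun x => - (u x + P * x)) a c b => //.
  - by move=> x; apply: cvgN; exact: cv.
  - by rewrite ltrN2.
  - by rewrite ltrN2.
  by apply: (nomin x); apply: filterS T => y; rewrite lerN2.
have [P0|P0|P0] := ltgtP P 0.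
- have mono x y : x <= y -> u y + P * y <= u x + P * x.
    rewrite le_eqVlt => /predU1P[->//|xy].
    (* For [P < 0] the value at [x - 1] is larger by [- P], so an increase from [x] to [y] would
       create a dip at [x]. *)
    rewrite leNgt; apply/negP => h; apply: (nodip (x - 1) x y) => //.
      by rewrite ltrBlDr ltrDl.
    by have := pu (x - 1); rewrite subrK => ->; lra.
  have : u 1 + P * 1 + F 1 <= u 0 + P * 0 + F 0.
    apply: (touch_below_nonincreasing (fun x => u x + P * x + F x)) ler01.
      by move=> x; apply: cvgD; [exact: cv|exact: cF].
    move=> phi dphi x Cphi T.
    have C := is_C1D _ _ _ _ Cphi (is_C1N _ _ CF).
    have T' : touch_below (fun y => u y + P * y) (fun y => phi y + - F y) x.
      by apply: filterS T => y /=; lra.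
    have := touch _ _ x C T'.
    (* Monotonicity decides the sign of the slope [dphi x - f x]; its modulus being at least [f x],
       it is at most [- f x], hence [dphi x <= 0]. *)
    have : dphi x + - f x <= 0.
      apply: is_derive_le0_right (C.1 x) _.
      by apply: filterS T' => y + /ltW/mono; lra.
    by move=> /ler0_norm ->; lra.
  by rewrite ltr0_norm// u10; lra.
- have mono x y : x <= y -> u x + P * x <= u y + P * y.
    rewrite le_eqVlt => /predU1P[->//|xy].
    rewrite leNgt; apply/negP => h; apply: (nodip x y (y + 1)) => //.
      by rewrite ltrDl.
    by rewrite pu; lra.
  have : u 0 + P * 0 - F 0 <= u 1 + P * 1 - F 1.
    apply: (touch_below_nondecreasing (fun x => u x + P * x - F x)) ler01.
      by move=> x; apply: cvgB; [exact: cv|exact: cF].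
    move=> phi dphi x Cphi T.
    have C := is_C1D _ _ _ _ Cphi CF.
    have T' : touch_below (fun y => u y + P * y) (fun y => phi y + F y) x.
      by apply: filterS T => y /=; lra.
    have := touch _ _ x C T'.
    have : 0 <= dphi x + f x.
      apply: is_derive_ge0_left (C.1 x) _.
      by apply: filterS T' => y + /ltW/mono; lra.
    by move=> /ger0_norm ->; lra.
  by rewrite gtr0_norm// u10; lra.
(* For [P = 0] the periodic function [u] itself has a minimum, which is excluded. *)
- have [x xmin] := periodic_min _ pu cu.
  exfalso; apply: (nomin x); apply/near_ballP; exists 1 => // y _.
  by rewrite P0 !mul0r !addr0.
Qed.

(** * Construction of solutions *)

Lemma lipschitz_onT {R : realType} (u : R -> R) (B : R) :
  (forall x y, `|u x - u y| <= B * `|x - y|) -> [lipschitz u x | x in [set: R]].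
Proof.
move=> H; rewrite /lipschitz_on; near=> M => -[x y] _; change (`|u x - u y| <= M * `|x - y|).
by rewrite (le_trans (H x y))// ler_wpM2r//; near: M; exact: nbhs_pinfty_ge.
Unshelve. all: by end_near. Qed.

Lemma primitive_shift {R : realType} (F f : R -> R) (x : R) :
  is_C1 F f -> periodic f 1 -> F (x + 1) = F x + (F 1 - F 0).
Proof.
move=> [dF _] pf.
have d0 (y : R) : is_derive y 1 (fun t => F (t + 1) - F t) (f (y + 1) * (1 + 0) - f y).
  apply: is_deriveBf; apply: (is_derive_comp F (fun t => t + 1)).
have /(_ x 0) := is_derive_0_is_cst (f := fun t => F (t + 1) - F t).
rewrite add0r => H; suff : F (x + 1) - F x = F 1 - F 0 by lra.
apply: H => y; have := d0 y; by rewrite pf addr0 mulr1 subrr.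
Qed.

Lemma primitive_lipschitz {R : realType} (F f : R -> R) :
  is_C1 F f -> periodic f 1 ->
  exists B, forall x y, `|F x - F y| <= B * `|x - y|.
Proof.
move=> [dF cf] pf; have [B HB] := periodic_bounded _ pf cf.
exists B => x y; apply: (is_derive_lipschitz _ _ (Num.min x y) (Num.max x y) _ _ _ dF).
- by move=> z _; exact: HB.
- by rewrite ge_min le_max !lexx.
- by rewrite ge_min le_max !lexx !orbT.
Qed.

(** The function [G x - P * x] is differentiable, so every test slope at [x] equals its derivative
    [g x - P]. The signed [g] allows both [G = F] and [G = - F]. *)
Lemma smooth_solution {R : realType} (G g : R -> R) (P : R) :
  is_C1 G g -> periodic g 1 -> P = G 1 - G 0 ->
  exists u, [/\ Lip_torus u,
    forall x p, superdifferential u x p -> p + P = g x &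
    forall x p, subdifferential u x p -> p + P = g x].
Proof.
move=> CG pg PE; exists (fun x => G x + - (P * x)).
have du (x : R) : is_derive x 1 (fun x => G x + - (P * x)) (g x + - P).
  exact: (is_C1D _ _ _ _ CG (is_C1N _ _ (is_C1_linear P))).1.
split.
- split; first by move=> x; rewrite (primitive_shift _ _ _ CG pg) PE; ring.
  have [B GB] := primitive_lipschitz _ _ CG pg.
  apply: (lipschitz_onT _ (B + `|P|)) => x y.
  rewrite (_ : _ - _ = (G x - G y) + - P * (x - y)); last by ring.
  by rewrite (le_trans (ler_normD _ _))// normrM normrN mulrDl lerD2r.
- move=> x p /superdifferential_is_derive[phi dphi H].
  have := is_derive_max _ _ _ (is_deriveBf _ _ _ _ _ (du x) dphi).
  move=> E; suff : g x + - P - p = 0 by lra.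
  by apply: E; apply: (@nearW _ (nbhs x)) => y; exact: H.
- move=> x p /subdifferential_is_derive[phi dphi H].
  have := is_derive_max _ _ _ (is_deriveBf _ _ _ _ _ dphi (du x)).
  move=> E; suff : p - (g x + - P) = 0 by lra.
  by apply: E; apply: (@nearW _ (nbhs x)) => y; have := H y; lra.
Qed.

Section MinOfCones.
Context {R : realType} (F f : R -> R) (x0 P : R).
Hypotheses (CF : is_C1 F f) (pf : periodic f 1) (f0 : forall x, 0 <= f x).
Hypotheses (Fx0 : F x0 = 0) (fx0 : f x0 = 0) (PI : `|P| <= F 1 - F 0).

Let I := F 1 - F 0.
(** The cone with slopes [f] and [- f], vertex [x0 + n] and value [n * P] there; moving [x] by [1]
    and [n] by [1] adds [P]. *)
Let cone (n : int) (x : R) := n%:~R * P + `|F x - n%:~R * I|.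
Let k x := Num.floor (x - x0).
(* The minimum of all the cones, attained at one of the two consecutive vertices
   [x0 + n] enclosing [x]. *)
Let v x := Num.min (cone (k x) x) (cone (k x + 1) x).

Let F_nondecreasing x y : x <= y -> F x <= F y.
Proof.
by move=> xy; apply: (is_derive_ge0_le F f x y CF.1 xy) => z _; exact: f0.
Qed.

Let F_int (n : int) : F (x0 + n%:~R) = n%:~R * I.
Proof.
have FD (m : nat) x : F (x + m%:R) = F x + m%:R * I.
  elim: m x => [|m IH] x; first by rewrite addr0 mul0r addr0.
  by rewrite -natr1 addrA (primitive_shift _ _ _ CF pf) IH -/I; ring.
case: n => m; first by rewrite -pmulrn FD Fx0 add0r.
rewrite NegzE mulrNz -pmulrn; have := FD m.+1 (x0 - m.+1%:R).
by rewrite subrK Fx0 mulNr; lra.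
Qed.

(** To the left of [x] ([n <= k x]) the cone at [x] is [F x - n * (I - P)], to the right it is
    [n * (I + P) - F x]. Since [|P| <= I], the first is nonincreasing and the second nondecreasing
    in [n], so the two vertices around [x] suffice. *)
Let v_le_cone n x : v x <= cone n x.
Proof.
have /andP[k1 k2] := floor_itv (x - x0).
have F1 : (k x)%:~R * I <= F x by rewrite -F_int F_nondecreasing// -lerBrDl.
have F2 : F x <= (k x + 1)%:~R * I.
  by rewrite -F_int F_nondecreasing// -lerBlDl ltW.
move: (PI); rewrite ler_norml -/I => /andP[IP1 IP2].
have I0 : 0 <= I by lra.
rewrite /v ge_min /cone; case: (leP n (k x)) => [nk|kn]; apply/orP; [left|right].
  have nk' : n%:~R <= (k x)%:~R :> R by rewrite ler_int.
  rewrite !ger0_norm; nra.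
have kn' : (k x + 1)%:~R <= n%:~R :> R by rewrite ler_int lezD1.
rewrite !ler0_norm; nra.
Qed.

Let v_cone x : exists n, v x = cone n x.
Proof. by rewrite /v /Num.min; case: ifP => _; eexists. Qed.

Let v_le x y : v y <= v x + `|F y - F x|.
Proof.
have [n ->] := v_cone x; apply: le_trans (v_le_cone n y) _.
rewrite /cone -addrA lerD2l [leRHS]addrC.
have -> : F y - n%:~R * I = (F y - F x) + (F x - n%:~R * I) by rewrite addrA subrK.
exact: ler_normD.
Qed.

Let v_shift x : v (x + 1) = v x + P.
Proof.
have coneS n y : cone (n + 1) (y + 1) = cone n y + P.
  rewrite /cone (primitive_shift _ _ _ CF pf) intrD mulr1z -/I.
  rewrite (_ : F y + I - _ = F y - n%:~R * I); first by ring.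
  by ring.
apply/eqP; rewrite eq_le; apply/andP; split.
  by have [n ->] := v_cone x; rewrite -coneS.
have [n ->] := v_cone (x + 1).
by rewrite -[n](subrK 1) coneS lerD2r.
Qed.

(** The nondecreasing [F] takes the same value at [x] and at [x0 + n], so it is constant between
    them and its derivative at [x] vanishes. Thus no supersolution condition remains where a cone
    may have its vertex. *)
Let f_vertex n x : F x = n%:~R * I -> f x = 0.
Proof.
rewrite -F_int => E; apply/eqP; rewrite eq_le f0 andbT.
have [xn|nx|->] := ltgtP x (x0 + n%:~R).
- apply: is_derive_le0_right (CF.1 x) _; rewrite E.
  apply/near_ballP; exists (x0 + n%:~R - x); first by rewrite subr_gt0.
  move=> y; rewrite ltr_norml => /andP[_ yx] _; apply: F_nondecreasing; lra.
- apply: is_derive_le0_left (CF.1 x) _; rewrite E.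
  apply/near_ballP; exists (x - (x0 + n%:~R)); first by rewrite subr_gt0.
  move=> y; rewrite ltr_norml => /andP[yx _] _; apply: F_nondecreasing; lra.
- by rewrite (periodic_int _ _ _ _ pf) fx0.
Qed.

Lemma min_of_cones_solution :
  exists u, [/\ Lip_torus u,
    forall x p, superdifferential u x p -> `|p + P| <= f x &
    forall x p, subdifferential u x p -> f x <= `|p + P|].
Proof.
exists (fun x => v x - P * x); split.
- split; first by move=> x; rewrite v_shift; ring.
  have [B FB] := primitive_lipschitz _ _ CF pf.
  apply: (lipschitz_onT _ (B + `|P|)) => x y.
  rewrite (_ : _ - _ = (v x - v y) + - P * (x - y)); last by ring.
  rewrite (le_trans (ler_normD _ _))// normrM normrN mulrDl lerD2r.
  rewrite (le_trans _ (FB x y))// ler_norml.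
  by have := v_le x y; have := v_le y x; rewrite distrC => *; apply/andP; split; lra.
- move=> x p /superdifferential_is_derive[phi dphi H].
  have dpsi := is_deriveDf _ _ _ _ _ dphi (is_derive_linear P x).
  rewrite ler_norml; apply/andP; split.
    suff : 0 <= p + P + f x by lra.
    apply: is_derive_ge0_right (is_deriveDf _ _ _ _ _ dpsi (CF.1 x)) _.
    apply: (@nearW _ (nbhs x)) => y /ltW/F_nondecreasing Fxy.
    (* Every cone, hence [v], varies by at most the variation of [F]; this bounds the test slope by
       [f x]. *)
    have := H y; have := v_le y x.
    by rewrite distrC ger0_norm ?subr_ge0//; lra.
  suff : p + P - f x <= 0 by lra.
  apply: is_derive_le0_left (is_deriveBf _ _ _ _ _ dpsi (CF.1 x)) _.
  apply: (@nearW _ (nbhs x)) => y /ltW/F_nondecreasing Fxy.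
  have := H y; have := v_le y x.
  by rewrite ger0_norm ?subr_ge0//; lra.
- move=> x p /subdifferential_is_derive[phi dphi H].
  have dpsi := is_deriveDf _ _ _ _ _ dphi (is_derive_linear P x).
  have cF : {for x, continuous F} := is_C1_continuous _ _ CF x.
  (* A function touching [v] from below at [x] also touches the cone active at [x], since [v] lies
     below it; away from its vertices this cone is [F] or [- F] up to a constant. *)
  have [n vn] := v_cone x.
  have [Fn|Fn|/f_vertex ->//] := ltgtP (F x) (n%:~R * I).
    suff : p + P + f x = 0.
      by move=> E; rewrite (_ : p + P = - f x) ?normrN ?ger0_norm//; lra.
    apply: is_derive_max (is_deriveDf _ _ _ _ _ dpsi (CF.1 x)) _.
    have : \forall y \near x, F y < n%:~R * I by exact: (cvgr_lt _ cF).
    apply: filterS => y Fy.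
    have := H y; have := v_le_cone n y; rewrite vn /cone.
    by rewrite !ltr0_norm ?subr_lt0//; lra.
  suff : p + P - f x = 0.
    by move=> E; rewrite (_ : p + P = f x) ?ger0_norm//; lra.
  apply: is_derive_max (is_deriveBf _ _ _ _ _ dpsi (CF.1 x)) _.
  have : \forall y \near x, n%:~R * I < F y by exact: (cvgr_gt _ cF).
  apply: filterS => y Fy.
  have := H y; have := v_le_cone n y; rewrite vn /cone.
  by rewrite !gtr0_norm ?subr_gt0//; lra.
Qed.

End MinOfCones.

(** * Primitives of continuous functions *)

Lemma continuous_integrable_itv {R : realType} (f : R -> R) (a b : R) :
  continuous f -> lebesgue_measure.-integrable `[a, b] (EFin \o f).
Proof.
move=> cf; apply: continuous_compact_integrable; first exact: segment_compact.
exact: continuous_subspaceT.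
Qed.

Lemma continuous_primitive {R : realType} (f : R -> R) :
  continuous f -> exists F, is_C1 F f.
Proof.
move=> cf.
pose G (a x : R) := (\int[lebesgue_measure]_(t in `[a, x]) f t)%R.
pose F (x : R) := if 0 <= x then (\int[lebesgue_measure]_(t in `]0%R, x]) f t)%R
                  else - (\int[lebesgue_measure]_(t in `]x, 0%R]) f t)%R.
(* To the right of any [a < 0], [F] is an integral from the fixed left end [a] up to a constant, so
   the fundamental theorem applies at every [x], of either sign. *)
have FE (a x : R) : a < 0 -> a < x -> F x = G a x - G a 0.
  move=> a0 ax; rewrite /F /G; case: ifPn => [x0|]; last first.
    rewrite -ltNge => x0.
    rewrite -(@Rintegral_itvB _ _ (BLeft a) (BRight 0) x) ?opprB//.
    - exact: continuous_integrable_itv.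
    - by rewrite bnd_simp ltW.
    - by rewrite bnd_simp ltW.
  rewrite -(@Rintegral_itvB _ _ (BLeft a) (BRight x) 0)//.
  - exact: continuous_integrable_itv.
  - by rewrite bnd_simp ltW.
exists F; split=> // x.
pose a := Num.min x 0 - 1.
have ax : a < x by rewrite ltrBlDr (@le_lt_trans _ _ x)// ?ge_min ?lexx ?ltrDl.
have a0 : a < 0 by rewrite ltrBlDr (@le_lt_trans _ _ 0)// ?ge_min ?lexx ?orbT ?ltrDl.
apply: (near_eq_is_derive (f := fun y => G a y + - G a 0)).
  near=> y; rewrite (FE a)//; near: y; exact: lt_nbhsr.
rewrite -[X in is_derive _ _ _ X]addr0.
have x1 : x < x + 1 by rewrite ltrDl.
have [dG GE] := continuous_FTC1_closed x1 (continuous_integrable_itv f a (x + 1) cf) ax (cf x).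
have dG' : is_derive x 1 (G a) (f x) by apply: DeriveDef => //; rewrite -derive1E.
exact: is_deriveDf.
Unshelve. all: by end_near. Qed.

Lemma integral_unit_primitive {R : realType} (F f : R -> R) : is_C1 F f ->
  (\int[lebesgue_measure]_(z in `]0%R, 1%R[) (f z)%:E = (F 1 - F 0)%:E)%E.
Proof.
move=> CF; have cF := is_C1_continuous _ _ CF; have [dF cf] := CF.
have fi := continuous_integrable_itv f 0 1 cf.
rewrite -(@integral_itv_bndoo _ 0 1 _ true false); last first.
  by apply: (measurable_funS _ _ (measurable_int _ fi)) => //; exact: subset_itv_oo_cc.
rewrite (continuous_FTC2 (F := F)) ?EFinB//.
- exact: continuous_subspaceT.
- split.
  + by move=> x _; have [] := dF x.
  + by apply: cvg_at_right_filter; exact: cF.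
  + by apply: cvg_at_left_filter; exact: cF.
- by move=> x _; rewrite derive1E; have [] := dF x.
Qed.

(** * The cell problem *)

Lemma lipschitz_on_bound {R : realType} (u : R -> R) (A : set R) :
  [lipschitz u x | x in A] ->
  exists2 L : R, 0 <= L & forall x y, A x -> A y -> `|u x - u y| <= L * `|x - y|.
Proof.
move=> Lu.
have [M [M0 HM]] : exists M : R, 0 <= M /\ M.-lipschitz_on u (globally (A `*` A)).
  apply: (@filter_ex _ (pinfty_nbhs R)); apply: filterI; last exact: Lu.
  exact: nbhs_pinfty_ge.
by exists M => // x y Ax Ay; exact: (HM (x, y)).
Qed.

Lemma Lip_torus_bound {R : realType} (u : R -> R) : Lip_torus u ->
  continuous u /\ exists2 L, 0 <= L & forall x y, `|u x - u y| <= L * `|x - y|.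
Proof.
move=> [_ /lipschitz_on_bound[L L0 HL]].
have uL x y : `|u x - u y| <= L * `|x - y| by exact: HL.
split; last by exists L.
move=> x; apply/cvgrPdist_lt => e e0; apply/near_ballP.
exists (e / (L + 1)) => [|y yx]; first by rewrite divr_gt0//; lra.
apply: le_lt_trans (uL x y) _; rewrite distrC.
move: yx; rewrite ltr_pdivlMr; last lra.
have := normr_ge0 (y - x); nra.
Qed.

Lemma touch_below_lipschitz {R : realType} (u phi : R -> R) (x d L : R) :
  (forall x y, `|u x - u y| <= L * `|x - y|) ->
  is_derive x 1 phi d -> touch_below u phi x -> `|d| <= L.
Proof.
move=> uL dphi T; rewrite ler_norml; apply/andP; split.
  suff : 0 <= d + L by lra.
  apply: is_derive_ge0_left (is_deriveDf _ _ _ _ _ dphi (is_derive_linear L x)) _.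
  apply: filterS T => y T yx; have := uL y x; have := ler_norm (u y - u x).
  by rewrite [`|y - x|]ltr0_norm ?subr_lt0//; lra.
suff : d - L <= 0 by lra.
apply: is_derive_le0_right (is_deriveBf _ _ _ _ _ dphi (is_derive_linear L x)) _.
apply: filterS T => y T xy; have := uL y x; have := ler_norm (u y - u x).
by rewrite [`|y - x|]gtr0_norm ?subr_gt0//; lra.
Qed.

Section Hamiltonian.
Context {R : realType} (sigma m : R -> R).
Hypotheses (sigma_periodic : periodic sigma 1) (sigma_continuous : continuous sigma)
  (sigma_gt0 : forall x : R, 0 < sigma x)
  (m_itv : forall r : R, 0 <= r -> 0 < m r < 1)
  (m_lipschitz : [lipschitz m r | r in `[0, +oo[%classic])
  (m_increasing : forall r s : R, 0 <= r -> r < s -> m r < m s)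
  (m_cvg1 : m r @[r --> +oo] --> (1 : R)).

Let H := hamiltonian sigma m.
Let smax := sigma_max sigma.
Let smin := sigma_min sigma.
Let a0 := smax * m 0.

(** * Extrema of [sigma] and inversion of [m] *)

Lemma sigma_max_attained :
  exists2 x, sigma x = smax & forall y, sigma y <= smax.
Proof.
have [x xmax] := periodic_max _ sigma_periodic sigma_continuous.
have E : smax = sigma x.
  apply/eqP; rewrite eq_le; apply/andP; split.
    by apply: ge_sup; [exists (sigma x); exists x|move=> _ [y _ <-]].
  by apply: ub_le_sup; [exists (sigma x) => _ [y _ <-]|exists x].
by exists x; rewrite ?E.
Qed.

Lemma sigma_min_attained :
  exists2 x, sigma x = smin & forall y, smin <= sigma y.
Proof.
have [x xmin] := periodic_min _ sigma_periodic sigma_continuous.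
have E : smin = sigma x.
  apply/eqP; rewrite eq_le; apply/andP; split.
    by apply: ge_inf; [exists (sigma x) => _ [y _ <-]|exists x].
  by apply: lb_le_inf; [exists (sigma x); exists x|move=> _ [y _ <-]].
by exists x; rewrite ?E.
Qed.

Lemma sigma_min_gt0 : 0 < smin.
Proof. by have [x <- _] := sigma_min_attained. Qed.

Let a0_gt0 : 0 < a0.
Proof.
have [x sx _] := sigma_max_attained; have /andP[m00 _] := m_itv 0 (lexx 0).
by rewrite mulr_gt0// -sx.
Qed.

Lemma m_lt r s : 0 <= r -> 0 <= s -> (m r < m s) = (r < s).
Proof.
move=> r0 s0; apply/idP/idP => [|rs]; last exact: m_increasing.
apply: contraTT; rewrite -!leNgt le_eqVlt => /predU1P[->//|sr].
by rewrite ltW// m_increasing.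
Qed.

Lemma m_le r s : 0 <= r -> 0 <= s -> (m r <= m s) = (r <= s).
Proof. by move=> r0 s0; rewrite !leNgt m_lt. Qed.

(** The absolute value gives a function continuous on the whole line, whatever [m] is on the
    negative reals. *)
Lemma m_abs_continuous : continuous (fun r : R => m `|r|).
Proof.
have [L L0 mL] := lipschitz_on_bound _ _ m_lipschitz.
move=> x; apply/cvgrPdist_lt => e e0; apply/near_ballP.
exists (e / (L + 1)) => [|y yx]; first by rewrite divr_gt0//; lra.
apply: le_lt_trans (mL _ _ _ _) _; rewrite /= ?in_itv/= ?andbT//.
apply: le_lt_trans (ler_wpM2l L0 (ler_dist_dist x y)) _; rewrite distrC.
move: yx; rewrite ltr_pdivlMr; last lra.
have := normr_ge0 (y - x); nra.
Qed.

Lemma m_surjective y : m 0 <= y < 1 -> exists2 r, 0 <= r & m r = y.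
Proof.
move=> /andP[y0 y1].
have [T [T0 yT]] : exists T : R, 0 <= T /\ y < m T.
  apply: (@filter_ex _ (pinfty_nbhs R)); apply: filterI.
    exact: nbhs_pinfty_ge.
  exact: (cvgr_gt _ m_cvg1).
have mT : m 0 <= m T by rewrite m_le.
have [||r rT mr] := @IVT _ (fun r : R => m `|r|) 0 T y T0.
- by apply: continuous_subspaceT; exact: m_abs_continuous.
- by rewrite normr0 ger0_norm// min_l// max_r// y0 ltW.
have r0 : 0 <= r by move: rT; rewrite in_itv => /andP[].
by exists r => //; rewrite -mr ger0_norm.
Qed.

(* Uniform continuity of the inverse of [m] on [[m 0, m T]]. *)
Lemma m_inverse_modulus T e : 0 <= T -> 0 < e ->
  exists2 d, 0 < d & forall r s, 0 <= r <= T -> 0 <= s ->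
    m s < m r + d -> s < r + e.
Proof.
move=> T0 e0.
have cd : continuous (fun r : R => m `|r + e| - m `|r|).
  move=> r; apply: cvgB; last exact: m_abs_continuous.
  apply: (@continuous_comp _ _ _ (fun r => r + e) (fun r : R => m `|r|)).
    by apply: cvgD; [exact: cvg_id|exact: cvg_cst].
  exact: m_abs_continuous.
(* The modulus is the least increment [m (r + e) - m r] over the compact [[0, T]], positive by
   strict monotonicity. *)
have [c] := EVT_min T0 (continuous_subspaceT cd : {within `[0, T], continuous _}).
rewrite in_itv /= => /andP[c0 cT] cmin.
exists (m `|c + e| - m `|c|).
  by rewrite subr_gt0 !ger0_norm ?m_increasing//; lra.
move=> r s /andP[r0 rT] s0 ms; rewrite ltNge; apply/negP => rs.
have := cmin r; rewrite in_itv /= r0 rT => /(_ isT).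
rewrite (ger0_norm r0) [`|r + e|]ger0_norm; last lra.
have : m (r + e) <= m s by rewrite m_le//; lra.
lra.
Qed.

(* The real-valued form of [f_ sigma m a], which is finite for [a < smin]. *)
Let g (a x : R) : R := 'pinv_(fun=> 0) `[0, +oo[%classic m (a / sigma x).

Lemma pinv_m y : m 0 <= y < 1 ->
  0 <= 'pinv_(fun=> 0) `[0, +oo[%classic m y /\
  m ('pinv_(fun=> 0) `[0, +oo[%classic m y) = y.
Proof.
move=> y01; have [r r0 mr] := m_surjective _ y01.
have ym : [set m r | r in `[0, +oo[%classic] y.
  by exists r => //=; rewrite in_itv/= andbT.
split; last by apply: pinvK; rewrite inE.
have S : set_surj `[0, +oo[%classic [set m r | r in `[0, +oo[%classic] m by [].
have := @surjpinv_image_sub _ _ (fun=> 0) _ _ _ S.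
move=> /(_ ('pinv_(fun=> 0) `[0, +oo[%classic m y)).
by rewrite /= in_itv/= andbT; apply; exists y.
Qed.

(** Excluding the quotient [1] rather than the level [smin] keeps the statement usable for
    [f_ sigma m smin] away from the minimum points of [sigma]. *)
Lemma div_sigma_itv a x : a0 <= a -> a <= smin -> a / sigma x != 1 ->
  m 0 <= a / sigma x < 1.
Proof.
move=> a0a asmin ne.
have [_ _ /(_ x) sM] := sigma_max_attained.
have [_ _ /(_ x) sm] := sigma_min_attained.
have /andP[m00 _] := m_itv 0 (lexx 0).
rewrite lt_neqAle ne ler_pdivlMr// ler_pdivrMr// mul1r (le_trans asmin)// andbT.
by rewrite mulrC (le_trans _ a0a)// ler_wpM2r// ltW.
Qed.

Lemma div_sigma_neq1 a x : a < smin -> a / sigma x != 1.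
Proof.
have [_ _ /(_ x) sm] := sigma_min_attained.
by move=> as_; rewrite lt_eqF// ltr_pdivrMr// mul1r (lt_le_trans as_).
Qed.

Lemma pinv_m_div a x : a0 <= a -> a < smin -> 0 <= g a x /\ m (g a x) = a / sigma x.
Proof.
by move=> aa as_; apply/pinv_m/div_sigma_itv; rewrite ?div_sigma_neq1// ltW.
Qed.

Lemma g_ge0 a x : a0 <= a -> a < smin -> 0 <= g a x.
Proof. by move=> ? ?; have [] := pinv_m_div a x. Qed.

Lemma sigma_m_g a x : a0 <= a -> a < smin -> sigma x * m (g a x) = a.
Proof.
move=> aa as_; have [_ ->] := pinv_m_div a x aa as_.
by rewrite mulrC divfK// gt_eqF.
Qed.

Lemma le_g a x r : a0 <= a -> a < smin -> 0 <= r ->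
  (r <= g a x) = (sigma x * m r <= a).
Proof.
move=> aa as_ r0; rewrite -[in RHS](sigma_m_g a x aa as_) ler_pM2l//.
by rewrite m_le// g_ge0.
Qed.

Lemma lt_g a x r : a0 <= a -> a < smin -> 0 <= r ->
  (r < g a x) = (sigma x * m r < a).
Proof.
move=> aa as_ r0; rewrite -[in RHS](sigma_m_g a x aa as_) ltr_pM2l//.
by rewrite m_lt// g_ge0.
Qed.

Lemma ge_g a x r : a0 <= a -> a < smin -> 0 <= r ->
  (g a x <= r) = (a <= sigma x * m r).
Proof. by move=> aa as_ r0; rewrite !leNgt lt_g. Qed.

Lemma g_periodic a : periodic (g a) 1.
Proof. by move=> x; rewrite /g sigma_periodic. Qed.

Lemma g_lt a b x : a0 <= a -> a < b -> b < smin -> g a x < g b x.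
Proof.
move=> aa ab bs; have as_ := lt_trans ab bs.
by rewrite lt_g ?g_ge0 ?sigma_m_g// ltW// (le_lt_trans aa).
Qed.

(** A joint modulus in level and position gives both the continuity of [g a] and that of the
    integral in [a]. Levels up to [b < smin] keep [g] below [T], its value at level [b] and a
    minimum point of [sigma], so the modulus of the inverse of [m] applies. *)
Lemma g_uniform_modulus b e : a0 <= b -> b < smin -> 0 < e ->
  exists2 d, 0 < d & forall a a' x x', a0 <= a <= b -> a0 <= a' <= b ->
    `|a / sigma x - a' / sigma x'| < d -> `|g a x - g a' x'| < e.
Proof.
move=> ab bs e0.
have [xm sxm smin_le] := sigma_min_attained.
have [] := pinv_m_div b xm ab bs; set T := g b xm => T0 mT.
have gT a x : a0 <= a -> a <= b -> g a x <= T.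
  move=> aa ab'; have as_ := le_lt_trans ab' bs.
  rewrite ge_g// mT sxm mulrA; apply: le_trans ab' _.
  rewrite ler_pdivlMr ?sigma_min_gt0// mulrC ler_wpM2r//.
  by rewrite (le_trans _ ab)// ltW// a0_gt0.
have [d d0 Hd] := m_inverse_modulus T e T0 e0.
exists d => // a a' x x' /andP[aa a_b] /andP[aa' a_b'].
have [as_ as'] := (le_lt_trans a_b bs, le_lt_trans a_b' bs).
have [G0 mG] := pinv_m_div a x aa as_.
have [G0' mG'] := pinv_m_div a' x' aa' as'.
rewrite -mG -mG' !ltr_norml => /andP[d1 d2].
have h1 : g a x < g a' x' + e by apply: Hd; rewrite ?G0' ?gT//; lra.
have h2 : g a' x' < g a x + e by apply: Hd; rewrite ?G0 ?gT//; lra.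
by apply/andP; split; lra.
Qed.

Lemma g_continuous a : a0 <= a -> a < smin -> continuous (g a).
Proof.
move=> aa as_ x; apply/cvgrPdist_lt => e e0.
have [d d0 Hd] := g_uniform_modulus a e aa as_ e0.
have ca : {for x, continuous (fun y => a / sigma y)}.
  apply: cvgM; first exact: cvg_cst.
  by apply: cvgV; [rewrite gt_eqF|exact: sigma_continuous].
have /cvgrPdist_lt/(_ d d0) := ca.
by apply: filterS => y; apply: Hd; rewrite aa lexx.
Qed.

Lemma g_primitive a : a0 <= a -> a < smin -> exists F, is_C1 F (g a).
Proof. by move=> aa as_; apply: continuous_primitive; exact: g_continuous. Qed.

Lemma f_finite a x : a0 <= a -> a < smin -> f_ sigma m a x = (g a x)%:E.
Proof. by move=> aa as_; rewrite /f_ /m_inv (negPf (div_sigma_neq1 _ _ as_)). Qed.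

(** Determines [f_] by its strict lower bounds, also where it is [+oo]: there [a = sigma x], and the
    right-hand side holds because [m r < 1]. *)
Lemma lt_f a x r : a0 <= a -> a <= smin -> 0 <= r ->
  (r%:E < f_ sigma m a x)%E = (sigma x * m r < a).
Proof.
move=> aa as_ r0; have /andP[_ mr1] := m_itv r r0.
rewrite /f_ /m_inv; case: ifPn => [/eqP E|ne].
  have -> : a = sigma x by rewrite -[LHS](divfK (lt0r_neq0 (sigma_gt0 x))) E mul1r.
  by rewrite ltry gtr_pMr.
have [r0' mE] := pinv_m _ (div_sigma_itv _ _ aa as_ ne).
by rewrite lte_fin -m_lt// mE ltr_pdivlMr// mulrC.
Qed.

Lemma f_ge0 a x : a0 <= a -> a <= smin -> (0 <= f_ sigma m a x)%E.
Proof.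
move=> aa as_; rewrite /f_ /m_inv; case: ifPn => [_|ne]; first exact: leey.
by have [] := pinv_m _ (div_sigma_itv _ _ aa as_ ne).
Qed.

(** * The integral as a function of the level *)

Let I (a : R) : \bar R :=
  (\int[lebesgue_measure]_(z in `]0%R, 1%R[) f_ sigma m a z)%E.

Let I_primitive a F : a0 <= a -> a < smin -> is_C1 F (g a) ->
  I a = (F 1 - F 0)%:E.
Proof.
move=> aa as_ CF; rewrite -(integral_unit_primitive _ _ CF).
by apply: eq_integral => x _; exact: f_finite.
Qed.

Let J (a : R) : R := fine (I a).

Let J_primitive a F : a0 <= a -> a < smin -> is_C1 F (g a) ->
  J a = F 1 - F 0.
Proof. by move=> aa as_ CF; rewrite /J (I_primitive _ _ aa as_ CF). Qed.

Lemma I_fin a : a0 <= a -> a < smin -> I a = (J a)%:E.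
Proof.
move=> aa as_; have [F CF] := g_primitive a aa as_.
by rewrite /J (I_primitive _ _ aa as_ CF).
Qed.

(** The mean value theorem, applied on [[0, 1]] to a difference of primitives, reduces strict
    monotonicity and continuity of [J] to pointwise facts on [g]. *)
Lemma J_sub_mean_value a b : a0 <= a -> a < smin -> a0 <= b -> b < smin ->
  exists c, J b - J a = g b c - g a c.
Proof.
move=> aa as_ ab bs.
have [F CF] := g_primitive a aa as_; have [G CG] := g_primitive b ab bs.
rewrite (J_primitive _ _ aa as_ CF) (J_primitive _ _ ab bs CG).
have dGF (x : R) : is_derive x 1 (fun x => G x - F x) (g b x - g a x).
  by apply: is_deriveBf; [exact: CG.1|exact: CF.1].
have [c _ E] := is_derive_mean_value _ _ 0 1 dGF ler01.
by exists c; move: E; rewrite subr0 mulr1 => <-; ring.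
Qed.

Lemma J_increasing a b : a0 <= a -> a < b -> b < smin -> J a < J b.
Proof.
move=> aa ab bs.
have [c E] := J_sub_mean_value a b aa (lt_trans ab bs) (le_trans aa (ltW ab)) bs.
by rewrite -subr_gt0 E subr_gt0 g_lt.
Qed.

Lemma J_continuous b : a0 <= b -> b < smin -> {within `[a0, b], continuous J}.
Proof.
move=> ab bs; apply/subspace_continuousP => x; rewrite /= in_itv/= => /andP[ax xb].
apply/cvgrPdist_lt => e e0; rewrite near_withinE; apply/near_ballP.
have [d d0 Hd] := g_uniform_modulus b e ab bs e0.
(* The modulus concerns quotients by [sigma c], which is at least [smin]. *)
exists (d * smin) => [|y yx]; first by rewrite mulr_gt0// sigma_min_gt0.
rewrite /= in_itv/= => /andP[ay yb].
have [c ->] := J_sub_mean_value y x ay (le_lt_trans yb bs) ax (le_lt_trans xb bs).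
apply: Hd; rewrite ?ax ?ay//.
rewrite -mulrBl normrM distrC [`|_^-1|]gtr0_norm ?invr_gt0// ltr_pdivrMr//.
have [_ _ /(_ c) sm] := sigma_min_attained.
by rewrite (lt_le_trans yx)// ler_wpM2l// ltW.
Qed.

Lemma J_intermediate_value b P : a0 <= b -> b < smin -> J a0 <= P <= J b ->
  exists2 c, a0 <= c <= b & J c = P.
Proof.
move=> ab bs /andP[JP PJ]; have JJ := le_trans JP PJ.
have [||c] := @IVT _ J a0 b P ab; first exact: J_continuous.
  by rewrite min_l// max_r// JP PJ.
by rewrite in_itv/= => cab; exists c.
Qed.

Lemma f_nondecreasing a b x : a0 <= a -> a <= b -> b <= smin ->
  (f_ sigma m a x <= f_ sigma m b x)%E.
Proof.
move=> aa ab bs; have ab0 := le_trans aa ab; rewrite leNgt; apply/negP.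
have := f_ge0 b x ab0 bs; case E : (f_ sigma m b x) => [r| |]//; last first.
  by move=> _; rewrite ltNge leey.
rewrite lee_fin => r0; rewrite lt_f//; last exact: le_trans ab bs.
by move=> h; have := lt_f b x r ab0 bs r0; rewrite E ltxx (lt_le_trans h).
Qed.

(** * Approach to the level [smin] from below *)

Section Approximation.
Hypothesis a0_lt : a0 < smin.

Let s (n : nat) := smin - (smin - a0) * n.+1%:R^-1.

Let s_ge n : a0 <= s n.
Proof.
rewrite /s lerBrDl -lerBrDr -[leRHS]mulr1.
by rewrite ler_wpM2l ?subr_ge0 ?(ltW a0_lt)// invf_le1// ler1n.
Qed.

Let s_lt n : s n < smin.
Proof. by rewrite /s gtrBl mulr_gt0// subr_gt0. Qed.

Let s_nondecreasing n k : (n <= k)%N -> s n <= s k.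
Proof.
move=> nk; rewrite /s lerD2l lerN2 ler_wpM2l ?subr_ge0 ?(ltW a0_lt)//.
by rewrite lef_pV2 ?posrE// ler_nat.
Qed.

Let s_approx y : y < smin -> exists n, y < s n.
Proof.
move=> ys; have e0 : 0 < (smin - y) / (smin - a0) by rewrite divr_gt0// subr_gt0.
have [n _ /(_ n (leqnn n))] := near_infty_natSinv_lt (PosNum e0).
rewrite /= ltr_pdivlMr ?subr_gt0// mulrC => h.
by exists n; rewrite /s ltrBrDl -ltrBrDr.
Qed.

(** A supremum [r] below the limit would give [sigma x * m r < smin], hence [sigma x * m r < s n]
    for some [n], that is [r < f_ sigma m (s n) x]. This covers infinite limits too. *)
Let f_s_cvg x : f_ sigma m (s n) x @[n --> \oo] --> f_ sigma m smin x.
Proof.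
have nd : {homo (fun n => f_ sigma m (s n) x) : n k / (n <= k)%N >-> (n <= k)%E}.
  by move=> n k nk; rewrite f_nondecreasing ?s_ge ?s_nondecreasing// ltW// s_lt.
suff <- : ereal_sup (range (fun n => f_ sigma m (s n) x)) = f_ sigma m smin x.
  exact: ereal_nondecreasing_cvgn.
apply/eqP; rewrite eq_le; apply/andP; split.
  by apply: ge_ereal_sup => _ [n _ <-]; rewrite f_nondecreasing ?s_ge// ltW// s_lt.
rewrite leNgt; apply/negP => lt_sup.
have sup_ge n : (f_ sigma m (s n) x <= ereal_sup (range (fun n => f_ sigma m (s n) x)))%E.
  by apply: ereal_sup_ubound; exists n.
have sup_ge0 := le_trans (f_ge0 _ x (s_ge 0) (ltW (s_lt 0))) (sup_ge 0%N).
move: sup_ge sup_ge0 lt_sup; case: (ereal_sup _) => [r sup_ge|_|_]//.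
  rewrite lee_fin => r0; rewrite lt_f ?(ltW a0_lt)// => /s_approx[n].
  by rewrite -lt_f ?s_ge ?(ltW (s_lt n))// ltNge sup_ge.
by move=> _; rewrite ltNge leey.
Qed.

Lemma measurable_f_s n : measurable_fun (`]0, 1[%classic : set R) (f_ sigma m (s n)).
Proof.
have -> : f_ sigma m (s n) = EFin \o g (s n).
  by apply/funext => x; rewrite f_finite ?s_ge ?s_lt.
have gi := continuous_integrable_itv _ 0 1 (g_continuous _ (s_ge n) (s_lt n)).
by apply: (measurable_funS _ _ (measurable_int _ gi)) => //; exact: subset_itv_oo_cc.
Qed.

Lemma measurable_f_smin : measurable_fun (`]0, 1[%classic : set R) (f_ sigma m smin).
Proof.
apply: (measurable_realfun.emeasurable_fun_cvg (fun n => f_ sigma m (s n))).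
  exact: measurable_f_s.
by move=> x _; exact: f_s_cvg.
Qed.

Let I_cvg : I (s n) @[n --> \oo] --> I smin.
Proof.
have -> : I smin = (\int[lebesgue_measure]_(z in `]0%R, 1%R[)
    limn (fun n => f_ sigma m (s n) z))%E.
  by apply: eq_integral => x _; apply/esym/cvg_lim => //; exact: f_s_cvg.
apply: cvg_monotone_convergence => //.
- exact: measurable_f_s.
- by move=> n x _; rewrite f_ge0 ?s_ge// ltW// s_lt.
- by move=> x _ n k nk; rewrite f_nondecreasing ?s_ge ?s_nondecreasing// ltW// s_lt.
Qed.

(** Strictness comes from a level [s n] between [b] and [smin], where both integrals are finite; it
    makes the solvability interval open. *)
Lemma I_lt_smin b : a0 <= b -> b < smin -> (I b < I smin)%E.
Proof.
move=> ab bs; have [n bn] := s_approx _ bs.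
apply: (@lt_le_trans _ _ (I (s n))).
  rewrite !I_fin ?s_ge ?s_lt// lte_fin; exact: J_increasing (s_lt n).
apply: ge0_le_integral => //.
- by move=> x _; rewrite f_ge0 ?s_ge// ltW// s_lt.
- exact: measurable_f_s.
- exact: measurable_f_smin.
- by move=> x _; rewrite f_nondecreasing ?s_ge// ltW// s_lt.
Qed.

Lemma lt_I_smin P : (P%:E < I smin)%E -> exists b, [/\ a0 <= b, b < smin & P < J b].
Proof.
move=> PI.
have nd : {homo (fun n => I (s n)) : n k / (n <= k)%N >-> (n <= k)%E}.
  move=> n k nk; rewrite !I_fin ?s_ge ?s_lt// lee_fin.
  have := s_nondecreasing _ _ nk; rewrite le_eqVlt => /predU1P[->//|nk'].
  by rewrite ltW// J_increasing ?s_ge ?s_lt.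
move: PI; rewrite -(cvg_lim _ I_cvg)// (cvg_lim _ (ereal_nondecreasing_cvgn nd))//.
move=> /ereal_sup_gt[_ [n _ <-]].
by rewrite I_fin ?s_ge ?s_lt// lte_fin => Pn; exists (s n); rewrite s_ge s_lt.
Qed.

Lemma integrable_f_sminE : lebesgue_measure.-integrable `]0%R, 1%R[ (f_ sigma m smin) <->
  I smin \is a fin_num.
Proof.
split=> [|If]; first exact: integrable_fin_num.
apply/integrableP; split; first exact: measurable_f_smin.
rewrite (_ : (\int[_]_(x in _) _)%E = I smin) ?ltey_eq ?If//.
by apply: eq_integral => x _; rewrite gee0_abs// f_ge0// ltW.
Qed.

End Approximation.

(** * Solvability and critical values *)

Lemma cell_solution_bounds P u a : cell_solution H P u a -> a0 <= a < smin.
Proof.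
move=> [Lu [sub super]]; have [cu [L L0 uL]] := Lip_torus_bound _ Lu.
have [pu _] := Lu.
apply/andP; split.
  rewrite leNgt; apply/negP => aa.
  have [xM sxM _] := sigma_max_attained.
  (* As [m] is least at [0], near a maximum point of [sigma] no slope at all satisfies the
     subsolution inequality at a level below [a0]. *)
  have cs : {for xM, continuous (fun y => sigma y * m 0)}.
    by apply: cvgM; [exact: sigma_continuous|exact: cvg_cst].
  have : \forall y \near xM, a < sigma y * m 0.
    by apply: (cvgr_gt _ cs); rewrite sxM.
  move=> /near_ballP[d d0 Hd].
  have [x [phi [dphi [xd C T]]]] := touch_above_exists _ xM _ cu d0.
  have := sub x _ (touch_above_superdifferential _ _ _ _ pu cu C T).
  rewrite subr_le0 /H /hamiltonian leNgt (lt_le_trans (Hd x xd))//.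
  by rewrite ler_pM2l// m_le.
rewrite ltNge; apply/negP => sa.
have [xm sxm _] := sigma_min_attained.
(* Test slopes are at most [L] in modulus, and [m (L + |P|) < 1] strictly; so near a minimum point
   of [sigma] the Hamiltonian stays below [smin]. *)
have B0 : 0 <= L + `|P| by rewrite addr_ge0.
have /andP[_ mB] := m_itv _ B0.
have cs : {for xm, continuous (fun y => sigma y * m (L + `|P|))}.
  by apply: cvgM; [exact: sigma_continuous|exact: cvg_cst].
have : \forall y \near xm, sigma y * m (L + `|P|) < a.
  apply: (cvgr_lt _ cs); rewrite sxm (lt_le_trans _ sa)// gtr_pMr//.
  exact: sigma_min_gt0.
move=> /near_ballP[d d0 Hd].
have [x [phi [dphi [xd C T]]]] := touch_below_exists _ xm _ cu d0.
have := super x _ (touch_below_subdifferential _ _ _ _ pu cu C T).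
have dL := touch_below_lipschitz _ _ _ _ _ uL (C.1 x) T.
rewrite subr_ge0 /H /hamiltonian leNgt (le_lt_trans _ (Hd x xd))//.
by rewrite ler_pM2l// m_le// (le_trans (ler_normD _ _))// lerD2r.
Qed.

Lemma cell_solution_norm_bounds P u a : cell_solution H P u a ->
  `|P| <= J a /\ (a0 < a -> J a <= `|P|).
Proof.
move=> Hu; have /andP[aa as_] := cell_solution_bounds _ _ _ Hu.
have [Lu [sub super]] := Hu; have [cu _] := Lip_torus_bound _ Lu.
have [pu _] := Lu; have [F CF] := g_primitive a aa as_.
rewrite (J_primitive _ _ aa as_ CF); split.
  apply: (subsolution_bound _ _ _ _ pu cu CF) => x p /sub.
  by rewrite subr_le0 le_g.
move=> a0a; apply: (supersolution_bound _ _ _ _ pu cu CF).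
  move=> x; apply: le_lt_trans (g_lt _ _ x (lexx a0) a0a as_).
  by rewrite g_ge0// (lt_trans a0a).
by move=> x p /super; rewrite subr_ge0 ge_g.
Qed.

Lemma cell_solution_of_g P u a : a0 <= a -> a < smin -> Lip_torus u ->
  (forall x p, superdifferential u x p -> `|p + P| <= g a x) ->
  (forall x p, subdifferential u x p -> g a x <= `|p + P|) ->
  cell_solution H P u a.
Proof.
move=> aa as_ Lu sub super; split=> //; split=> x p.
  by move=> /sub; rewrite le_g// subr_le0.
by move=> /super; rewrite ge_g// subr_ge0.
Qed.

Lemma cell_solution_critical P : a0 < smin -> `|P| <= J a0 ->
  exists u, cell_solution H P u a0.
Proof.
move=> as_; have [F CF] := g_primitive a0 (lexx _) as_.
rewrite (J_primitive _ _ (lexx _) as_ CF) => PJ.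
have [x0 sx0 _] := sigma_max_attained.
have CF0 : is_C1 (fun x => F x - F x0) (g a0).
  split; last exact: CF.2.
  move=> x; rewrite -[X in is_derive _ _ _ X]subr0.
  by apply: is_deriveBf (CF.1 x) _; exact: is_derive_cst.
have gx0 : g a0 x0 = 0.
  by apply/eqP; rewrite eq_le g_ge0// ge_g// sx0 lexx.
have [|||||u [Lu sub super]] := min_of_cones_solution (fun x => F x - F x0) (g a0) x0 P CF0.
- exact: g_periodic.
- by move=> x; rewrite g_ge0.
- by rewrite subrr.
- by [].
- by rewrite (_ : _ - _ = F 1 - F 0)//; ring.
by exists u; apply: cell_solution_of_g.
Qed.

Lemma cell_solution_noncritical P a : a0 <= a -> a < smin -> `|P| = J a ->
  exists u, cell_solution H P u a.
Proof.
move=> aa as_; have [F CF] := g_primitive a aa as_.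
rewrite (J_primitive _ _ aa as_ CF) => PJ.
have gp := g_periodic a; have gg x := g_ge0 a x aa as_.
have [P0|P0] := leP 0 P.
  have [|u [Lu sub super]] := smooth_solution F (g a) P CF gp.
    by rewrite -PJ ger0_norm.
  exists u; apply: cell_solution_of_g => // x p.
    by move=> /sub ->; rewrite ger0_norm.
  by move=> /super ->; rewrite ger0_norm.
have [||u [Lu sub super]] := smooth_solution _ _ P (is_C1N _ _ CF).
- by move=> x; rewrite gp.
- by move: PJ; rewrite ltr0_norm//; lra.
exists u; apply: cell_solution_of_g => // x p.
  by move=> /sub ->; rewrite normrN ger0_norm.
by move=> /super ->; rewrite normrN ger0_norm.
Qed.

Lemma solvability_setE : a0 < smin ->
  forall P, solvability_set H P <-> (`|P|%:E < I smin)%E.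
Proof.
move=> as_ P; split.
  move=> [u [a Hu]]; have /andP[aa as'] := cell_solution_bounds _ _ _ Hu.
  have [PJ _] := cell_solution_norm_bounds _ _ _ Hu.
  by apply: le_lt_trans (I_lt_smin as_ a aa as'); rewrite I_fin// lee_fin.
move=> /(lt_I_smin as_)[b [ab bs PJ]].
have [P0|P0] := leP `|P| (J a0).
  by have [u Hu] := cell_solution_critical _ as_ P0; exists u, a0.
have [|c /andP[ac cb] Jc] := J_intermediate_value b `|P| ab bs; first by rewrite !ltW.
have cs := le_lt_trans cb bs.
by have [u Hu] := cell_solution_noncritical P c ac cs (esym Jc); exists u, c.
Qed.

Lemma solvability_set_empty : smin <= a0 -> solvability_set H = set0.
Proof.
move=> sa; apply/seteqP; split=> // P [u [a /cell_solution_bounds/andP[aa as_]]].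
by have := lt_le_trans as_ sa; rewrite ltNge aa.
Qed.

(** A level [c > a0] would give [J c <= |P| <= J a0], against the strict monotonicity of [J]. *)
Lemma critical_value_eq_min P c : is_critical_value H P c ->
  (`|P|%:E <= I a0)%E -> c = a0.
Proof.
move=> [u Hu]; have /andP[ac cs] := cell_solution_bounds _ _ _ Hu.
rewrite I_fin// ?(le_lt_trans ac)// lee_fin => PJ.
have [_ +] := cell_solution_norm_bounds _ _ _ Hu.
move: ac; rewrite le_eqVlt => /predU1P[->//|ac] /(_ ac) JP.
by have := lt_le_trans (J_increasing _ _ (lexx _) ac cs) (le_trans JP PJ); rewrite ltxx.
Qed.

(** The equality with a singleton records both that [c] solves [|P| = I c] and that no other
    admissible level does. *)
Lemma critical_value_level P c : is_critical_value H P c ->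
  (I a0 < `|P|%:E)%E ->
  [set a : R | a0 <= a < smin /\ `|P|%:E = I a] = [set c].
Proof.
move=> [u Hu]; have /andP[ac cs] := cell_solution_bounds _ _ _ Hu.
have as_ := le_lt_trans ac cs.
have [PJ JP] := cell_solution_norm_bounds _ _ _ Hu.
rewrite I_fin// lte_fin => JP0.
have {}ac : a0 < c.
  rewrite lt_neqAle ac andbT; apply/eqP => E.
  by move: JP0; rewrite ltNge {1}E PJ.
have PE : `|P| = J c by apply/eqP; rewrite eq_le PJ JP.
apply/seteqP; split=> [a [/andP[aa as'] /eqP]|_ ->] /=.
  rewrite I_fin// eqe PE => /eqP JJ; apply/eqP.
  have [h|h|//] := ltgtP a c.
    by have := J_increasing _ _ aa h cs; rewrite JJ ltxx.
  by have := J_increasing _ _ (ltW ac) h as'; rewrite JJ ltxx.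
by rewrite (ltW ac) cs I_fin ?(ltW ac)// PE.
Qed.

End Hamiltonian.

Theorem proposition4p1 (R : realType) (sigma m : R -> R)
  (sigma_periodic : periodic sigma 1)
  (sigma_continuous : continuous sigma)
  (sigma_gt0 : forall x : R, 0 < sigma x)
  (m_itv : forall r : R, 0 <= r -> 0 < m r < 1)
  (m_lipschitz : [lipschitz m r | r in `[0, +oo[%classic])
  (m_increasing : forall r s : R, 0 <= r -> r < s -> m r < m s)
  (m_cvg1 : m r @[r --> +oo] --> (1 : R)) :
  let H := hamiltonian sigma m in
  let D := solvability_set H in
  let smax := sigma_max sigma in
  let smin := sigma_min sigma in
  let m0 := m 0 in
  let I (a : R) : \bar R := (\int[lebesgue_measure]_(z in `]0%R, 1%R[) f_ sigma m a z)%E in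
  let integrable_f_smin :=
    lebesgue_measure.-integrable `]0%R, 1%R[ (f_ sigma m smin) in
  (smin <= smax * m0 -> D = set0) /\
  (smax * m0 < smin ->
    [/\ integrable_f_smin -> D = [set P : R | (- I smin < P%:E < I smin)%E],
        ~ integrable_f_smin -> D = [set: R] &
        forall P c : R, D P -> is_critical_value H P c ->
          ((`|P|%:E <= I (smax * m0)%R)%E -> c = smax * m0) /\
          ((I (smax * m0)%R < `|P|%:E)%E ->
             [set a : R | smax * m0 <= a < smin /\ `|P|%:E = I a] = [set c])]).
Proof.
move=> H D smax smin m0 I integrable_f_smin; split; first exact: solvability_set_empty.
move=> lt_min; have D_E (P : R) : D P <-> (`|P|%:E < I smin)%E.
  exact: solvability_setE.
have intE : integrable_f_smin <-> I smin \is a fin_num by exact: integrable_f_sminE.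
split.
- move=> /intE Ifin; apply/seteqP; split=> P /=.
    by move=> /D_E; rewrite -(fineK Ifin) -EFinN !lte_fin ltr_norml.
  by rewrite -(fineK Ifin) -EFinN !lte_fin -ltr_norml => h; apply/D_E; rewrite -(fineK Ifin).
- move=> nint; apply/seteqP; split=> // P _; apply/D_E.
  have I0 : (0 <= I smin)%E by apply: integral_ge0 => x _; apply: f_ge0 => //; exact: ltW.
  have /negP : ~ I smin \is a fin_num by move=> /intE.
  by rewrite ge0_fin_numE// -leNgt leye_eq => /eqP ->; rewrite ltry.
- move=> P c _ Pc; split; [exact: critical_value_eq_min|exact: critical_value_level].
Qed.
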